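(* Let $\mathcal C$ be a fusion category over $\Bbbk$ and let $A=(A,m_A,u_A,\Delta_A,\varepsilon_A)$ be a special Frobenius algebra in $\mathcal C$. Then the functor $\Phi:\mathcal C\to{}_A\mathcal C_A$ given on objects by $X\mapsto(A\otimes X)\otimes A$ and on morphisms by $\varphi\mapsto(\mathrm{id}_A\otimes\varphi)\otimes\mathrm{id}_A$ is Frobenius monoidal, with the following structure morphisms. The monoidal structure $\Phi_{X,X'}:\Phi(X)\otimes_A\Phi(X')\to\Phi(X\otimes X')$ is determined by $\Phi_{X,X'}\,\pi_{\Phi(X),\Phi(X')}=\widetilde\Phi_{X,X'}$, where $$\widetilde\Phi_{X,X'}=(\alpha_{A,X,X'}\otimes\mathrm{id}_A)\,(\mathrm{id}_{A\otimes X}\otimes l_{X'}\otimes\mathrm{id}_A)\,(\mathrm{id}_{A\otimes X}\otimes\varepsilon_Am_A\otimes\mathrm{id}_{X'}\otimes\mathrm{id}_A)\,\underline\alpha,$$ $$\underline\alpha=(\mathrm{id}_{A\otimes X}\otimes\alpha^{-1}_{A,A,X'}\otimes\mathrm{id}_A)\,(\alpha_{A\otimes X,A,A\otimes X'}\otimes\mathrm{id}_A)\,\alpha^{-1}_{(A\otimes X)\otimes A,\,A\otimes X',\,A},$$ together with $\Phi_0=(r_A^{-1}\otimes\mathrm{id}_A)\Delta_A:A\to\Phi(\mathbf 1)$. The comonoidal structure is $\Phi^{X,X'}=\pi_{\Phi(X),\Phi(X')}\,\widetilde\Phi^{X,X'}:\Phi(X\otimes X')\to\Phi(X)\otimes_A\Phi(X')$,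 where $$\widetilde\Phi^{X,X'}=\underline{\alpha'}\,(\mathrm{id}_{A\otimes X}\otimes\Delta_Au_A\otimes\mathrm{id}_{X'}\otimes\mathrm{id}_A)\,(\mathrm{id}_{A\otimes X}\otimes l_{X'}^{-1}\otimes\mathrm{id}_A)\,(\alpha^{-1}_{A,X,X'}\otimes\mathrm{id}_A),$$ $$\underline{\alpha'}=\alpha_{(A\otimes X)\otimes A,\,A\otimes X',\,A}\,(\alpha^{-1}_{A\otimes X,A,A\otimes X'}\otimes\mathrm{id}_A)\,(\mathrm{id}_{A\otimes X}\otimes\alpha_{A,A,X'}\otimes\mathrm{id}_A),$$ together with $\Phi^0=m_A(r_A\otimes\mathrm{id}_A):\Phi(\mathbf 1)\to A$.
   Context: $\Bbbk$ is an algebraically closed field of characteristic $0$. A fusion category is a $\Bbbk$-linear, abelian, semisimple, finite, rigid monoidal category $(\mathcal C,\otimes,\mathbf 1,\alpha,l,r)$ with $\mathrm{End}(\mathbf 1)\cong\Bbbk$; $\alpha_{X,Y,Z}:(X\otimes Y)\otimes Z\to X\otimes(Y\otimes Z)$, $l_X:\mathbf 1\otimes X\to X$, $r_X:X\otimes\mathbf 1\to X$. Frobenius algebra in $\mathcal C$: $(A,m,u,\Delta,\varepsilon)$ where $(A,m,u)$ is an (associative unital) algebra, $(A,\Delta,\varepsilon)$ a (coassociative counital) coalgebra, and $(m\otimes\mathrm{id})\alpha^{-1}_{A,A,A}(\mathrm{id}\otimes\Delta)=\Delta m=(\mathrm{id}\otimes m)\alpha_{A,A,A}(\Delta\otimes\mathrm{id})$.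 Special: $m\Delta=\mathrm{id}_A$ and $\varepsilon u=\varphi\,\mathrm{id}_{\mathbf 1}$ for some nonzero $\varphi\in\Bbbk$. ${}_A\mathcal C_A$ is the category of $A$-bimodules $(M,\lambda_M,\rho_M)$ in $\mathcal C$. It is monoidal: $M\otimes_AN=\mathrm{coker}(\rho_M\otimes\mathrm{id}_N-(\mathrm{id}_M\otimes\lambda_N)\alpha_{M,A,N})$ with canonical projection $\pi_{M,N}:M\otimes N\to M\otimes_AN$ in $\mathcal C$ and induced bimodule structure; unit object $A$; associativity $\alpha^A$ determined by $\alpha^A_{X,X',X''}\pi_{X\otimes_AX',X''}(\pi_{X,X'}\otimes\mathrm{id})=\pi_{X,X'\otimes_AX''}(\mathrm{id}\otimes\pi_{X',X''})\alpha_{X,X',X''}$; unit constraints determined by $l^A_X\pi_{A,X}=\lambda_X$, $r^A_X\pi_{X,A}=\rho_X$. The object $\Phi(X)=(A\otimes X)\otimes A$ has the free bimodule structure $\rho_{\Phi(X)}=(\mathrm{id}_{A\otimes X}\otimes m_A)\alpha_{A\otimes X,A,A}$ and $\lambda_{\Phi(X)}=((m_A\otimes\mathrm{id}_X)\alpha^{-1}_{A,A,X}\otimes\mathrm{id}_A)\alpha^{-1}_{A,A\otimes X,A}$. In the displayed formulas, the parenthesization of tensor products of morphisms is the one dictated by sources and targets (e.g. $\underline\alpha:\Phi(X)\otimes\Phi(X')\to((A\otimes X)\otimes((A\otimes A)\otimes X'))\otimes A$). A monoidal functor $(F,F_{*,*},F_0):\mathcal C\to\mathcal D$ means lax monoidal: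 a natural transformation $F_{X,X'}:F(X)\otimes F(X')\to F(X\otimes X')$ and a morphism $F_0:\mathbf 1_{\mathcal D}\to F(\mathbf 1_{\mathcal C})$ (not required invertible) satisfying the usual associativity and unitality axioms. A comonoidal functor $(F,F^{*,*},F^0)$ is the dual notion, with $F^{X,X'}:F(X\otimes X')\to F(X)\otimes F(X')$ and $F^0:F(\mathbf 1_{\mathcal C})\to\mathbf 1_{\mathcal D}$, coassociative and counital. A Frobenius monoidal functor has both structures, such that for all $X,X',X''$: $(F_{X,X'}\otimes\mathrm{id})\,\alpha^{-1}_{F(X),F(X'),F(X'')}(\mathrm{id}\otimes F^{X',X''})=F^{X\otimes X',X''}F(\alpha^{-1}_{X,X',X''})F_{X,X'\otimes X''}$ and $(\mathrm{id}\otimes F_{X',X''})\,\alpha_{F(X),F(X'),F(X'')}(F^{X,X'}\otimes\mathrm{id})=F^{X,X'\otimes X''}F(\alpha_{X,X',X''})F_{X\otimes X',X''}$. *)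

(* Defs.v *)
From HB Require Import structures.
From mathcomp Require Import all_boot all_order all_algebra.
From mathcomp Require Import boolp.
Set Implicit Arguments.
Unset Strict Implicit.
Unset Printing Implicit Defensive.
Import GRing.Theory.
Local Open Scope ring_scope.

Declare Scope cat_scope.
Delimit Scope cat_scope with cat.
Local Open Scope cat_scope.

Reserved Notation "g ∘ f" (at level 45, right associativity).
Reserved Notation "X ⊗ Y" (at level 40, left associativity).
Reserved Notation "f ⊠ g" (at level 40, left associativity).

Record category := Category {
  ob :> Type;
  mor : ob -> ob -> Type;
  idm : forall X, mor X X;
  compose : forall X Y Z, mor Y Z -> mor X Y -> mor X Z;
  compA : forall X Y Z W (h : mor Z W) (g : mor Y Z) (f : mor X Y),
    compose h (compose g f) = compose (compose h g) f;
  comp1m : forall X Y (f : mor X Y), compose (idm Y) f = f;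
  compm1 : forall X Y (f : mor X Y), compose f (idm X) = f }.

Arguments mor {c}.
Arguments idm {c}.
Arguments compose {c X Y Z}.
Arguments compA {c X Y Z W}.
Arguments comp1m {c X Y}.
Arguments compm1 {c X Y}.

Notation "g ∘ f" := (compose g f) : cat_scope.

Definition mono (C : category) (X Y : C) (f : mor X Y) :=
  forall W (a b : mor W X), f ∘ a = f ∘ b -> a = b.

Definition epi (C : category) (X Y : C) (f : mor X Y) :=
  forall W (a b : mor Y W), a ∘ f = b ∘ f -> a = b.

Definition is_iso (C : category) (X Y : C) (f : mor X Y) :=
  exists g : mor Y X, g ∘ f = idm X /\ f ∘ g = idm Y.

Definition isomorphic (C : category) (X Y : C) := exists f : mor X Y, is_iso f.

Record functor (C D : category) := Functor {
  fob :> C -> D;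
  fmap : forall X Y, mor X Y -> mor (fob X) (fob Y);
  fmap1 : forall X, fmap (idm X) = idm (fob X);
  fmapM : forall X Y Z (g : mor Y Z) (f : mor X Y),
    fmap (g ∘ f) = fmap g ∘ fmap f }.

Arguments fmap {C D} f0 {X Y}.

Class monoidal (C : category) := Monoidal {
  tens : C -> C -> C;
  tensm : forall X X' Y Y', mor X X' -> mor Y Y' -> mor (tens X Y) (tens X' Y');
  munit : C;
  assoc : forall X Y Z, mor (tens (tens X Y) Z) (tens X (tens Y Z));
  associ : forall X Y Z, mor (tens X (tens Y Z)) (tens (tens X Y) Z);
  lunit : forall X, mor (tens munit X) X;
  luniti : forall X, mor X (tens munit X);
  runit : forall X, mor (tens X munit) X;
  runiti : forall X, mor X (tens X munit);
  tensm1 : forall X Y, tensm (idm X) (idm Y) = idm (tens X Y);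
  tensmM : forall X X' X'' Y Y' Y'' (f' : mor X' X'') (f : mor X X')
      (g' : mor Y' Y'') (g : mor Y Y'),
    tensm (f' ∘ f) (g' ∘ g) = tensm f' g' ∘ tensm f g;
  assoc_nat : forall X X' Y Y' Z Z' (f : mor X X') (g : mor Y Y') (h : mor Z Z'),
    assoc X' Y' Z' ∘ tensm (tensm f g) h = tensm f (tensm g h) ∘ assoc X Y Z;
  lunit_nat : forall X X' (f : mor X X'),
    lunit X' ∘ tensm (idm munit) f = f ∘ lunit X;
  runit_nat : forall X X' (f : mor X X'),
    runit X' ∘ tensm f (idm munit) = f ∘ runit X;
  assocK : forall X Y Z, associ X Y Z ∘ assoc X Y Z = idm _;
  associK : forall X Y Z, assoc X Y Z ∘ associ X Y Z = idm _;
  lunitK : forall X, luniti X ∘ lunit X = idm _;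
  lunitiK : forall X, lunit X ∘ luniti X = idm _;
  runitK : forall X, runiti X ∘ runit X = idm _;
  runitiK : forall X, runit X ∘ runiti X = idm _;
  pentagon : forall X Y Z W,
    assoc X Y (tens Z W) ∘ assoc (tens X Y) Z W
    = tensm (idm X) (assoc Y Z W) ∘ assoc X (tens Y Z) W
      ∘ tensm (assoc X Y Z) (idm W);
  triangle : forall X Y,
    tensm (idm X) (lunit Y) ∘ assoc X munit Y = tensm (runit X) (idm Y) }.

Arguments munit {C monoidal}.

Notation "X ⊗ Y" := (tens X Y) : cat_scope.
Notation "f ⊠ g" := (tensm f g) : cat_scope.

(* [Y] is a left dual of [X] (equivalently, [X] is a right dual of [Y]). *)
Definition left_dual (C : category) (M : monoidal C) (X Y : C) :=
  exists (ev : mor (Y ⊗ X) munit) (coev : mor munit (X ⊗ Y)),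
    runit X ∘ (idm X ⊠ ev) ∘ assoc X Y X ∘ (coev ⊠ idm X) ∘ luniti X = idm X
    /\ lunit Y ∘ (ev ⊠ idm Y) ∘ associ Y X Y ∘ (idm Y ⊠ coev) ∘ runiti Y
       = idm Y.

Definition rigid (C : category) (M : monoidal C) :=
  forall X : C, (exists Y, left_dual M X Y) /\ (exists Y, left_dual M Y X).

Section MonoidalFunctors.
Context (C D : category) (MC : monoidal C) (MD : monoidal D) (F : functor C D).

Record is_monoidal_functor
    (F2 : forall X X', mor (F X ⊗ F X') (F (X ⊗ X')))
    (F0 : mor munit (F munit)) : Prop := IsMonoidalFunctor {
  mf_nat : forall X Y X' Y' (f : mor X Y) (f' : mor X' Y'),
    F2 Y Y' ∘ (fmap F f ⊠ fmap F f') = fmap F (f ⊠ f') ∘ F2 X X';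
  mf_assoc : forall X X' X'',
    fmap F (assoc X X' X'') ∘ F2 (X ⊗ X') X'' ∘ (F2 X X' ⊠ idm (F X''))
    = F2 X (X' ⊗ X'') ∘ (idm (F X) ⊠ F2 X' X'') ∘ assoc (F X) (F X') (F X'');
  mf_lunit : forall X,
    fmap F (lunit X) ∘ F2 munit X ∘ (F0 ⊠ idm (F X)) = lunit (F X);
  mf_runit : forall X,
    fmap F (runit X) ∘ F2 X munit ∘ (idm (F X) ⊠ F0) = runit (F X) }.

Record is_comonoidal_functor
    (G2 : forall X X', mor (F (X ⊗ X')) (F X ⊗ F X'))
    (G0 : mor (F munit) munit) : Prop := IsComonoidalFunctor {
  cf_nat : forall X Y X' Y' (f : mor X Y) (f' : mor X' Y'),
    (fmap F f ⊠ fmap F f') ∘ G2 X X' = G2 Y Y' ∘ fmap F (f ⊠ f');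
  cf_assoc : forall X X' X'',
    assoc (F X) (F X') (F X'') ∘ (G2 X X' ⊠ idm (F X'')) ∘ G2 (X ⊗ X') X''
    = (idm (F X) ⊠ G2 X' X'') ∘ G2 X (X' ⊗ X'') ∘ fmap F (assoc X X' X'');
  cf_lunit : forall X,
    lunit (F X) ∘ (G0 ⊠ idm (F X)) ∘ G2 munit X = fmap F (lunit X);
  cf_runit : forall X,
    runit (F X) ∘ (idm (F X) ⊠ G0) ∘ G2 X munit = fmap F (runit X) }.

Record is_frobenius_monoidal_functor
    (F2 : forall X X', mor (F X ⊗ F X') (F (X ⊗ X')))
    (F0 : mor munit (F munit))
    (G2 : forall X X', mor (F (X ⊗ X')) (F X ⊗ F X'))
    (G0 : mor (F munit) munit) : Prop := IsFrobeniusMonoidalFunctor {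
  ff_monoidal : is_monoidal_functor F2 F0;
  ff_comonoidal : is_comonoidal_functor G2 G0;
  ff_frobl : forall X X' X'',
    (F2 X X' ⊠ idm (F X'')) ∘ associ (F X) (F X') (F X'')
      ∘ (idm (F X) ⊠ G2 X' X'')
    = G2 (X ⊗ X') X'' ∘ fmap F (associ X X' X'') ∘ F2 X (X' ⊗ X'');
  ff_frobr : forall X X' X'',
    (idm (F X) ⊠ F2 X' X'') ∘ assoc (F X) (F X') (F X'')
      ∘ (G2 X X' ⊠ idm (F X''))
    = G2 X (X' ⊗ X'') ∘ fmap F (assoc X X' X'') ∘ F2 (X ⊗ X') X'' }.

End MonoidalFunctors.

Record enriched_category (k : fieldType) := EnrichedCategory {
  enr_cat :> category;
  enr_class : forall X Y : enr_cat, GRing.Lmodule k (mor X Y) }.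

HB.instance Definition _ (k : fieldType) (C : enriched_category k) (X Y : C) :=
  GRing.Lmodule.copy (mor X Y) (GRing.Lmodule.Pack (enr_class X Y)).

Record lin_category (k : fieldType) := LinCategory {
  lin_cat :> enriched_category k;
  comp_linl : forall (X Y Z : lin_cat) (f : mor X Y),
    linear (fun g : mor Y Z => g ∘ f);
  comp_linr : forall (X Y Z : lin_cat) (g : mor Y Z),
    linear (fun f : mor X Y => g ∘ f) }.

Section LinearNotions.
Context (k : fieldType) (C : lin_category k).
Implicit Types X Y Z P S : C.

Definition is_zero Z :=
  (forall X (f : mor X Z), f = 0) /\ (forall X (f : mor Z X), f = 0).

Definition is_biproduct X Y B (i1 : mor X B) (i2 : mor Y B)
    (p1 : mor B X) (p2 : mor B Y) :=
  [/\ p1 ∘ i1 = idm X, p2 ∘ i2 = idm Y, p1 ∘ i2 = 0, p2 ∘ i1 = 0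
    & i1 ∘ p1 + i2 ∘ p2 = idm B].

Definition is_kernel X Y (f : mor X Y) K (i : mor K X) :=
  f ∘ i = 0
  /\ forall W (g : mor W X), f ∘ g = 0 -> exists! h : mor W K, i ∘ h = g.

Definition is_cokernel X Y (f : mor X Y) Q (p : mor Y Q) :=
  p ∘ f = 0
  /\ forall W (g : mor Y W), g ∘ f = 0 -> exists! h : mor Q W, h ∘ p = g.

Record cokernel X Y (f : mor X Y) := Cokernel {
  cok_ob : C;
  cok_proj : mor Y cok_ob;
  cok_univ : is_cokernel f cok_proj }.

(* An arbitrary choice of cokernels is part of the data, because the tensor
   product of bimodules is built from them. *)
Record abelian := Abelian {
  ab_zero : exists Z, is_zero Z;
  ab_biprod : forall X Y, exists B (i1 : mor X B) (i2 : mor Y B)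
    (p1 : mor B X) (p2 : mor B Y), is_biproduct i1 i2 p1 p2;
  ab_ker : forall X Y (f : mor X Y), exists K (i : mor K X), is_kernel f i;
  ab_coker : forall X Y (f : mor X Y), cokernel f;
  ab_mono : forall X Y (f : mor X Y), mono f ->
    exists Z (g : mor Y Z), is_kernel g f;
  ab_epi : forall X Y (f : mor X Y), epi f ->
    exists Z (g : mor Z X), is_cokernel g f }.

Definition simple S :=
  ~ is_zero S
  /\ forall Y (i : mor Y S), mono i -> is_zero Y \/ is_iso i.

Definition semisimple :=
  forall X, exists (n : nat) (S : 'I_n -> C)
      (i : forall j, mor (S j) X) (p : forall j, mor X (S j)),
    [/\ forall j, simple (S j),
        forall j, p j ∘ i j = idm (S j),
        forall j j', j != j' -> p j ∘ i j' = 0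
      & \sum_j (i j ∘ p j) = idm X].

Inductive finite_length : C -> Prop :=
  | finite_length_zero Z : is_zero Z -> finite_length Z
  | finite_length_ext X Y S (i : mor X Y) (p : mor Y S) :
      finite_length X -> simple S -> is_kernel p i -> is_cokernel i p ->
      finite_length Y.

Definition projective P :=
  forall X Y (e : mor X Y) (f : mor P Y), epi e -> exists h, e ∘ h = f.

Definition projective_cover P X (p : mor P X) :=
  [/\ projective P, epi p
    & forall P' (p' : mor P' X), projective P' -> epi p' ->
        exists2 h : mor P' P, epi h & p ∘ h = p'].

(* Finiteness in the sense of Etingof, Gelaki, Nikshych and Ostrik; for a
   semisimple category the second and third clauses are redundant. *)
Definition finite_category :=
  [/\ forall X Y, exists n (f : mor X Y -> 'rV[k]_n), linear f /\ bijective f,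
      forall X, finite_length X,
      forall S, simple S -> exists P (p : mor P S), projective_cover p
    & exists n (S : 'I_n -> C), (forall j, simple (S j))
        /\ forall T, simple T -> exists j, isomorphic T (S j)].

End LinearNotions.

Record fusion_category (k : fieldType) := FusionCategory {
  fus_lin :> lin_category k;
  fus_mon :: monoidal fus_lin;
  fus_tens_linl : forall (X X' Y Y' : fus_lin) (g : mor Y Y'),
    linear (fun f : mor X X' => f ⊠ g);
  fus_tens_linr : forall (X X' Y Y' : fus_lin) (f : mor X X'),
    linear (fun g : mor Y Y' => f ⊠ g);
  fus_abelian : abelian fus_lin;
  fus_semisimple : semisimple fus_lin;
  fus_finite : finite_category fus_lin;
  fus_rigid : rigid fus_mon;
  fus_end1 : bijective (fun c : k => c *: idm (munit : fus_lin)) }.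

Section Algebras.
Context (C : category) (M : monoidal C).

Record algebra := Algebra {
  alg_ob :> C;
  amul : mor (alg_ob ⊗ alg_ob) alg_ob;
  aone : mor munit alg_ob;
  amulA : amul ∘ (amul ⊠ idm alg_ob)
    = amul ∘ (idm alg_ob ⊠ amul) ∘ assoc alg_ob alg_ob alg_ob;
  amul1l : amul ∘ (aone ⊠ idm alg_ob) = lunit alg_ob;
  amul1r : amul ∘ (idm alg_ob ⊠ aone) = runit alg_ob }.

Record frobenius_algebra := FrobeniusAlgebra {
  frob_alg :> algebra;
  comul : mor frob_alg (frob_alg ⊗ frob_alg);
  counit : mor frob_alg munit;
  comulA : assoc frob_alg frob_alg frob_alg ∘ (comul ⊠ idm frob_alg) ∘ comul
    = (idm frob_alg ⊠ comul) ∘ comul;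
  comul1l : (counit ⊠ idm frob_alg) ∘ comul = luniti frob_alg;
  comul1r : (idm frob_alg ⊠ counit) ∘ comul = runiti frob_alg;
  frobl : (amul frob_alg ⊠ idm frob_alg)
      ∘ associ frob_alg frob_alg frob_alg ∘ (idm frob_alg ⊠ comul)
    = comul ∘ amul frob_alg;
  frobr : (idm frob_alg ⊠ amul frob_alg)
      ∘ assoc frob_alg frob_alg frob_alg ∘ (comul ⊠ idm frob_alg)
    = comul ∘ amul frob_alg }.

End Algebras.

Arguments amul {C M}.
Arguments aone {C M}.
Arguments comul {C M}.
Arguments counit {C M}.

Definition special (k : fieldType) (C : fusion_category k)
    (A : frobenius_algebra (fus_mon C)) :=
  amul A ∘ comul A = idm (A : C)
  /\ exists2 c : k, c != 0 & counit A ∘ aone A = c *: idm (munit : C).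

Section Bimodules.
Context (C : category) (M : monoidal C) (A : algebra M).

Record bimodule := Bimodule {
  bim_ob :> C;
  lact : mor (A ⊗ bim_ob) bim_ob;
  ract : mor (bim_ob ⊗ A) bim_ob;
  lactA : lact ∘ (amul A ⊠ idm bim_ob) = lact ∘ (idm A ⊠ lact) ∘ assoc A A bim_ob;
  lact1 : lact ∘ (aone A ⊠ idm bim_ob) = lunit bim_ob;
  ractA : ract ∘ (idm bim_ob ⊠ amul A) ∘ assoc bim_ob A A
    = ract ∘ (ract ⊠ idm A);
  ract1 : ract ∘ (idm bim_ob ⊠ aone A) = runit bim_ob;
  lractA : ract ∘ (lact ⊠ idm A) = lact ∘ (idm A ⊠ ract) ∘ assoc A bim_ob A }.

Record bimodule_hom (X Y : bimodule) := BimoduleHom {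
  bhom :> mor (X : C) Y;
  bhom_l : bhom ∘ lact X = lact Y ∘ (idm A ⊠ bhom);
  bhom_r : bhom ∘ ract X = ract Y ∘ (bhom ⊠ idm A) }.

Lemma bhom_inj X Y (f g : bimodule_hom X Y) : (f : mor _ _) = g -> f = g.
Proof.
case: f g => [f fl fr] [g gl gr] /= e; case: _ / e gl gr => gl gr.
by rewrite (Prop_irrelevance fl gl) (Prop_irrelevance fr gr).
Qed.

Definition bimodule_id X : bimodule_hom X X.
Proof.
by exists (idm (X : C)); rewrite tensm1 comp1m compm1.
Defined.

Definition bimodule_comp X Y Z (g : bimodule_hom Y Z) (f : bimodule_hom X Y) :
  bimodule_hom X Z.
Proof.
exists ((g : mor _ _) ∘ (f : mor _ _)).
- by rewrite -compA bhom_l compA bhom_l -compA -tensmM comp1m.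
- by rewrite -compA bhom_r compA bhom_r -compA -tensmM comp1m.
Defined.

Definition bimodule_category : category.
Proof.
refine (@Category bimodule bimodule_hom bimodule_id bimodule_comp _ _ _).
- by move=> *; apply: bhom_inj; apply: compA.
- by move=> *; apply: bhom_inj; apply: comp1m.
- by move=> *; apply: bhom_inj; apply: compm1.
Defined.

End Bimodules.

(* Most rewriting rules below are stated with a trailing morphism [x], so that
   they apply inside right-associated composites; [homext] introduces it. *)

Lemma homext (C : category) (X Y : C) (f g : mor X Y) :
  (forall W (x : mor W X), f ∘ x = g ∘ x) -> f = g.
Proof. by move=> e; rewrite -[f]compm1 -[g]compm1 e. Qed.

Lemma tail (C : category) (X Y : C) (f g : mor X Y) (e : f = g) W (x : mor W X) :
  f ∘ x = g ∘ x.
Proof. by rewrite e. Qed.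

Section MonoidalTheory.
Context (C : category) (M : monoidal C).
Implicit Types X Y Z W V : C.

Lemma wlM Z X Y W (g : mor Y W) (f : mor X Y) V (x : mor V (Z ⊗ X)) :
  (idm Z ⊠ (g ∘ f)) ∘ x = (idm Z ⊠ g) ∘ (idm Z ⊠ f) ∘ x.
Proof. by rewrite compA -tensmM comp1m. Qed.

Lemma wrM Z X Y W (g : mor Y W) (f : mor X Y) V (x : mor V (X ⊗ Z)) :
  ((g ∘ f) ⊠ idm Z) ∘ x = (g ⊠ idm Z) ∘ (f ⊠ idm Z) ∘ x.
Proof. by rewrite compA -tensmM comp1m. Qed.

Lemma wlM0 Z X Y W (g : mor Y W) (f : mor X Y) :
  idm Z ⊠ (g ∘ f) = (idm Z ⊠ g) ∘ (idm Z ⊠ f).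
Proof. by rewrite -tensmM comp1m. Qed.

Lemma wrM0 Z X Y W (g : mor Y W) (f : mor X Y) :
  (g ∘ f) ⊠ idm Z = (g ⊠ idm Z) ∘ (f ⊠ idm Z).
Proof. by rewrite -tensmM comp1m. Qed.

Lemma tensm_split X X' Y Y' (f : mor X X') (g : mor Y Y') :
  f ⊠ g = (f ⊠ idm Y') ∘ (idm X ⊠ g).
Proof. by rewrite -tensmM comp1m compm1. Qed.

Lemma wswap X X' Y Y' (f : mor X X') (g : mor Y Y') V (x : mor V (X ⊗ Y)) :
  (idm X' ⊠ g) ∘ (f ⊠ idm Y) ∘ x = (f ⊠ idm Y') ∘ (idm X ⊠ g) ∘ x.
Proof. by rewrite !compA -!tensmM !comp1m !compm1. Qed.

Lemma wswap0 X X' Y Y' (f : mor X X') (g : mor Y Y') :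
  (idm X' ⊠ g) ∘ (f ⊠ idm Y) = (f ⊠ idm Y') ∘ (idm X ⊠ g).
Proof. by rewrite -!tensmM !comp1m !compm1. Qed.

Lemma assocKt X Y Z V (x : mor V _) : associ X Y Z ∘ assoc X Y Z ∘ x = x.
Proof. by rewrite compA assocK comp1m. Qed.

Lemma associKt X Y Z V (x : mor V _) : assoc X Y Z ∘ associ X Y Z ∘ x = x.
Proof. by rewrite compA associK comp1m. Qed.

Lemma lunitKt X V (x : mor V _) : luniti X ∘ lunit X ∘ x = x.
Proof. by rewrite compA lunitK comp1m. Qed.

Lemma lunitiKt X V (x : mor V _) : lunit X ∘ luniti X ∘ x = x.
Proof. by rewrite compA lunitiK comp1m. Qed.

Lemma runitKt X V (x : mor V _) : runiti X ∘ runit X ∘ x = x.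
Proof. by rewrite compA runitK comp1m. Qed.

Lemma runitiKt X V (x : mor V _) : runit X ∘ runiti X ∘ x = x.
Proof. by rewrite compA runitiK comp1m. Qed.

Lemma lunit_natt X X' (f : mor X X') V (x : mor V _) :
  lunit X' ∘ (idm munit ⊠ f) ∘ x = f ∘ lunit X ∘ x.
Proof. by rewrite !compA lunit_nat. Qed.

Lemma runit_natt X X' (f : mor X X') V (x : mor V _) :
  runit X' ∘ (f ⊠ idm munit) ∘ x = f ∘ runit X ∘ x.
Proof. by rewrite !compA runit_nat. Qed.

Lemma luniti_nat X X' (f : mor X X') :
  (idm munit ⊠ f) ∘ luniti X = luniti X' ∘ f.
Proof.
by rewrite -[LHS]comp1m -(lunitK X') -compA lunit_natt lunitiK compm1.
Qed.

Lemma runiti_nat X X' (f : mor X X') :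
  (f ⊠ idm munit) ∘ runiti X = runiti X' ∘ f.
Proof.
by rewrite -[LHS]comp1m -(runitK X') -compA runit_natt runitiK compm1.
Qed.

Lemma luniti_natt X X' (f : mor X X') V (x : mor V _) :
  (idm munit ⊠ f) ∘ luniti X ∘ x = luniti X' ∘ f ∘ x.
Proof. by rewrite !compA luniti_nat. Qed.

Lemma runiti_natt X X' (f : mor X X') V (x : mor V _) :
  (f ⊠ idm munit) ∘ runiti X ∘ x = runiti X' ∘ f ∘ x.
Proof. by rewrite !compA runiti_nat. Qed.

Lemma assoc1 X X' Y Z (f : mor X X') V (x : mor V _) :
  assoc X' Y Z ∘ ((f ⊠ idm Y) ⊠ idm Z) ∘ x
  = (f ⊠ idm (Y ⊗ Z)) ∘ assoc X Y Z ∘ x.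
Proof. by rewrite compA assoc_nat tensm1 -compA. Qed.

Lemma assoc2 X Y Y' Z (f : mor Y Y') V (x : mor V _) :
  assoc X Y' Z ∘ ((idm X ⊠ f) ⊠ idm Z) ∘ x
  = (idm X ⊠ (f ⊠ idm Z)) ∘ assoc X Y Z ∘ x.
Proof. by rewrite compA assoc_nat -compA. Qed.

Lemma assoc3 X Y Z Z' (f : mor Z Z') V (x : mor V _) :
  assoc X Y Z' ∘ (idm (X ⊗ Y) ⊠ f) ∘ x
  = (idm X ⊠ (idm Y ⊠ f)) ∘ assoc X Y Z ∘ x.
Proof. by rewrite compA -tensm1 assoc_nat -compA. Qed.

Lemma associ1 X X' Y Z (f : mor X X') V (x : mor V _) :
  associ X' Y Z ∘ (f ⊠ idm (Y ⊗ Z)) ∘ x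
  = ((f ⊠ idm Y) ⊠ idm Z) ∘ associ X Y Z ∘ x.
Proof.
by rewrite -[RHS](assocKt (X := X')) assoc1 associKt.
Qed.

Lemma associ2 X Y Y' Z (f : mor Y Y') V (x : mor V _) :
  associ X Y' Z ∘ (idm X ⊠ (f ⊠ idm Z)) ∘ x
  = ((idm X ⊠ f) ⊠ idm Z) ∘ associ X Y Z ∘ x.
Proof.
by rewrite -[RHS](assocKt (X := X)) assoc2 associKt.
Qed.

Lemma associ3 X Y Z Z' (f : mor Z Z') V (x : mor V _) :
  associ X Y Z' ∘ (idm X ⊠ (idm Y ⊠ f)) ∘ x
  = (idm (X ⊗ Y) ⊠ f) ∘ associ X Y Z ∘ x.
Proof.
by rewrite -[RHS](assocKt (X := X)) assoc3 associKt.
Qed.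

Lemma wl_cancel X Y Z (g : mor Y X) (f : mor X Y) (e : g ∘ f = idm X)
    V (x : mor V (Z ⊗ X)) :
  (idm Z ⊠ g) ∘ (idm Z ⊠ f) ∘ x = x.
Proof. by rewrite -wlM e tensm1 comp1m. Qed.

Lemma wr_cancel X Y Z (g : mor Y X) (f : mor X Y) (e : g ∘ f = idm X)
    V (x : mor V (X ⊗ Z)) :
  (g ⊠ idm Z) ∘ (f ⊠ idm Z) ∘ x = x.
Proof. by rewrite -wrM e tensm1 comp1m. Qed.

Lemma pentagont X Y Z W V (x : mor V _) :
  assoc X Y (Z ⊗ W) ∘ assoc (X ⊗ Y) Z W ∘ x
  = (idm X ⊠ assoc Y Z W) ∘ assoc X (Y ⊗ Z) W ∘ (assoc X Y Z ⊠ idm W) ∘ x.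
Proof. by rewrite compA pentagon -!compA. Qed.

Lemma pentagon_a X Y Z W V (x : mor V _) :
  assoc (X ⊗ Y) Z W ∘ (associ X Y Z ⊠ idm W) ∘ associ X (Y ⊗ Z) W ∘ x
  = associ X Y (Z ⊗ W) ∘ (idm X ⊠ assoc Y Z W) ∘ x.
Proof.
rewrite -[LHS](assocKt (X := X)) pentagont (wr_cancel (associK _ _ _)).
by rewrite associKt.
Qed.

Lemma pentagon_b X Y Z W V (x : mor V _) :
  associ (X ⊗ Y) Z W ∘ associ X Y (Z ⊗ W) ∘ x
  = (associ X Y Z ⊠ idm W) ∘ associ X (Y ⊗ Z) W ∘ (idm X ⊠ associ Y Z W) ∘ x.
Proof.
apply: etrans (assocKt (X := X ⊗ Y) _); congr (_ ∘ _).
by rewrite pentagon_a (wl_cancel (associK _ _ _)).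
Qed.

Lemma pentagon_c X Y Z W V (x : mor V _) :
  (idm X ⊠ assoc Y Z W) ∘ assoc X (Y ⊗ Z) W ∘ x
  = assoc X Y (Z ⊗ W) ∘ assoc (X ⊗ Y) Z W ∘ (associ X Y Z ⊠ idm W) ∘ x.
Proof. by rewrite pentagont (wr_cancel (associK _ _ _)). Qed.

Lemma pentagon_d X Y Z W V (x : mor V _) :
  associ X (Y ⊗ Z) W ∘ (idm X ⊠ associ Y Z W) ∘ assoc X Y (Z ⊗ W) ∘ x
  = (assoc X Y Z ⊠ idm W) ∘ associ (X ⊗ Y) Z W ∘ x.
Proof.
rewrite -[LHS](wr_cancel (associK X Y Z)) -pentagon_b.
by rewrite assocKt.
Qed.

Lemma trianglet X Y V (x : mor V _) :
  (idm X ⊠ lunit Y) ∘ assoc X munit Y ∘ x = (runit X ⊠ idm Y) ∘ x.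
Proof. by rewrite compA triangle. Qed.

Lemma trianglei X Y V (x : mor V _) :
  (runit X ⊠ idm Y) ∘ associ X munit Y ∘ x = (idm X ⊠ lunit Y) ∘ x.
Proof. by rewrite -trianglet associKt. Qed.

Lemma trianglei' X Y :
  associ X munit Y ∘ (idm X ⊠ luniti Y) = runiti X ⊠ idm Y.
Proof.
apply: homext => V x; rewrite -compA.
rewrite -[LHS](wr_cancel (runitK _)) trianglei (wl_cancel (lunitiK _)) //.
Qed.

Lemma wl1_inj X Y (f g : mor X Y) : idm munit ⊠ f = idm munit ⊠ g -> f = g.
Proof.
move=> e; apply: homext => W x.
by rewrite -(lunitiKt x) -!lunit_natt e.
Qed.

Lemma wr1_inj X Y (f g : mor X Y) : f ⊠ idm munit = g ⊠ idm munit -> f = g.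
Proof.
move=> e; apply: homext => W x.
by rewrite -(runitiKt x) -!runit_natt e.
Qed.

Lemma lunit_tens X Y : lunit (X ⊗ Y) ∘ assoc munit X Y = lunit X ⊠ idm Y.
Proof.
apply: wl1_inj; apply: homext => V x.
rewrite -(associKt x).
rewrite -[associ _ _ _ ∘ x](wr_cancel (associK _ _ _)).
move: (_ ∘ associ _ _ _ ∘ x) => y.
rewrite wlM -pentagont trianglet -assoc2 -wrM triangle.
by rewrite -assoc1.
Qed.

Lemma runit_tens X Y :
  runit (X ⊗ Y) = (idm X ⊠ runit Y) ∘ assoc X Y munit.
Proof.
apply: wr1_inj; apply: homext => V x.
rewrite wrM -[LHS](assocKt (X := X)) -[RHS](assocKt (X := X)); congr (_ ∘ _).
rewrite assoc2 -trianglet assoc3 pentagont.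
by rewrite -wlM triangle.
Qed.

Lemma lunit_tenst X Y V (x : mor V _) :
  lunit (X ⊗ Y) ∘ assoc munit X Y ∘ x = (lunit X ⊠ idm Y) ∘ x.
Proof. by rewrite compA lunit_tens. Qed.

Lemma lunit_tensi X Y V (x : mor V _) :
  (lunit X ⊠ idm Y) ∘ associ munit X Y ∘ x = lunit (X ⊗ Y) ∘ x.
Proof. by rewrite -lunit_tenst associKt. Qed.

Lemma runit_tenst X Y V (x : mor V _) :
  (idm X ⊠ runit Y) ∘ assoc X Y munit ∘ x = runit (X ⊗ Y) ∘ x.
Proof. by rewrite runit_tens -compA. Qed.

End MonoidalTheory.

(* The reversed tensor product, which exchanges left and right. *)
Definition rev_monoidal (C : category) (M : monoidal C) : monoidal C.
Proof.
refine (@Monoidal C (fun X Y => Y ⊗ X) (fun X X' Y Y' f g => g ⊠ f) munit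
  (fun X Y Z => associ Z Y X) (fun X Y Z => assoc Z Y X)
  (@runit C M) (@runiti C M) (@lunit C M) (@luniti C M)
  _ _ _ _ _ _ _ _ _ _ _ _ _).
- by move=> X Y; apply: tensm1.
- by move=> *; apply: tensmM.
- move=> X X' Y Y' Z Z' f g h; apply: homext => W x.
  rewrite -[x in LHS](associKt (X := Z)) -!compA.
  by rewrite (compA (h ⊠ _)) -assoc_nat -!compA assocKt.
- by move=> *; apply: runit_nat.
- by move=> *; apply: lunit_nat.
- by move=> *; apply: associK.
- by move=> *; apply: assocK.
- by move=> *; apply: runitK.
- by move=> *; apply: runitiK.
- by move=> *; apply: lunitK.
- by move=> *; apply: lunitiK.
- move=> X Y Z W /=; apply: homext => V x; rewrite -!compA.
  exact: pentagon_b.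
- by move=> X Y /=; apply: homext => V x; rewrite -!compA trianglei.
Defined.

Lemma linear_zero (k : fieldType) (U V : lmodType k) (f : U -> V) :
  linear f -> f 0 = 0.
Proof. by move=> lf; have := lf (- 1) 0 0; rewrite !scaleN1r !addNr. Qed.

Lemma linear_sub (k : fieldType) (U V : lmodType k) (f : U -> V) :
  linear f -> forall u v, f (u - v) = f u - f v.
Proof.
by move=> lf u v; rewrite addrC -scaleN1r lf scaleN1r addrC.
Qed.

Lemma comp0m (k : fieldType) (C : lin_category k) (X Y Z : C) (f : mor X Y) :
  (0 : mor Y Z) ∘ f = 0.
Proof. exact: (linear_zero (@comp_linl k C X Y Z f)). Qed.

Lemma compm0 (k : fieldType) (C : lin_category k) (X Y Z : C) (g : mor Y Z) :
  g ∘ (0 : mor X Y) = 0.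
Proof. exact: (linear_zero (@comp_linr k C X Y Z g)). Qed.

Lemma compBm (k : fieldType) (C : lin_category k) (X Y Z : C)
    (g h : mor Y Z) (f : mor X Y) :
  (g - h) ∘ f = g ∘ f - h ∘ f.
Proof. exact: (linear_sub (@comp_linl k C X Y Z f)). Qed.

Lemma compmB (k : fieldType) (C : lin_category k) (X Y Z : C)
    (g : mor Y Z) (f h : mor X Y) :
  g ∘ (f - h) = g ∘ f - g ∘ h.
Proof. exact: (linear_sub (@comp_linr k C X Y Z g)). Qed.

Section LeftExactness.
Context (k : fieldType) (C : lin_category k) (M : monoidal C).
Hypothesis wl0 : forall (Z X Y : C), idm Z ⊠ (0 : mor X Y) = 0.
Context (D Z : C) (ev : mor (Z ⊗ D) munit) (coev : mor munit (D ⊗ Z)).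
Hypothesis zigzag :
  lunit Z ∘ (ev ⊠ idm Z) ∘ associ Z D Z ∘ (idm Z ⊠ coev) ∘ runiti Z = idm Z.

Let cup Y W (g : mor (Z ⊗ Y) W) : mor Y (D ⊗ W) :=
  (idm D ⊠ g) ∘ assoc D Z Y ∘ (coev ⊠ idm Y) ∘ luniti Y.

Let cap Y W (h : mor Y (D ⊗ W)) : mor (Z ⊗ Y) W :=
  lunit W ∘ (ev ⊠ idm W) ∘ associ Z D W ∘ (idm Z ⊠ h).

Let cupK Y W (g : mor (Z ⊗ Y) W) : cap (cup g) = g.
Proof.
rewrite /cap /cup; apply: homext => V x; rewrite -!compA !wlM.
rewrite associ3 -wswap lunit_natt; congr (_ ∘ _).
rewrite -pentagon_a associ2.
rewrite [associ _ _ _ ∘ _ ∘ x]compA trianglei' -assoc1 lunit_tenst -!wrM.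
by rewrite -!compA zigzag tensm1 comp1m.
Qed.

Let cup_nat X Y W (g : mor (Z ⊗ Y) W) (f : mor X Y) :
  cup (g ∘ (idm Z ⊠ f)) = cup g ∘ f.
Proof.
rewrite /cup; apply: homext => V x; rewrite -!compA wlM -assoc3.
by rewrite wswap luniti_natt.
Qed.

Lemma wl_epi_aux X Y (p : mor X Y) : epi p -> epi (idm Z ⊠ p).
Proof.
move=> ep W a b e; rewrite -(cupK a) -(cupK b); congr cap.
by apply: ep; rewrite -!cup_nat e.
Qed.

Lemma wl_desc_aux X Y Q (f : mor X Y) (p : mor Y Q) (W : C)
    (g : mor (Z ⊗ Y) W) :
  is_cokernel f p -> g ∘ (idm Z ⊠ f) = 0 -> exists h, h ∘ (idm Z ⊠ p) = g.
Proof.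
move=> [_ up] e.
have /up[h [eh _]] : cup g ∘ f = 0.
  rewrite -cup_nat e /cup wl0.
  exact: comp0m.
exists (cap h); rewrite -[RHS]cupK -eh /cap; apply: homext => V x.
by rewrite -!compA wlM.
Qed.

End LeftExactness.

Section FusionExactness.
Context (k : fieldType) (C : fusion_category k).
Implicit Types X Y Z W Q : C.

Lemma fus_wl0 Z X Y : idm Z ⊠ (0 : mor X Y) = 0.
Proof. exact: (linear_zero (@fus_tens_linr k C Z Z X Y (idm Z))). Qed.

Lemma fus_wr0 Z X Y : (0 : mor X Y) ⊠ idm Z = 0.
Proof. exact: (linear_zero (@fus_tens_linl k C X Y Z Z (idm Z))). Qed.

Lemma fus_wlB Z X Y (f g : mor X Y) :
  idm Z ⊠ (f - g) = idm Z ⊠ f - idm Z ⊠ g.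
Proof. exact: (linear_sub (@fus_tens_linr k C Z Z X Y (idm Z))). Qed.

Lemma fus_wrB Z X Y (f g : mor X Y) :
  (f - g) ⊠ idm Z = f ⊠ idm Z - g ⊠ idm Z.
Proof. exact: (linear_sub (@fus_tens_linl k C X Y Z Z (idm Z))). Qed.

Lemma wl_epi Z X Y (p : mor X Y) : epi p -> epi (idm Z ⊠ p).
Proof.
have [_ [D [ev [coev [_ zz]]]]] := @fus_rigid k C Z.
exact: (wl_epi_aux zz).
Qed.

Lemma wr_epi Z X Y (p : mor X Y) : epi p -> epi (p ⊠ idm Z).
Proof.
have [[D [ev [coev [zz _]]]] _] := @fus_rigid k C Z.
exact: (@wl_epi_aux k C (rev_monoidal (fus_mon C)) D Z ev coev zz).
Qed.

Lemma wl_desc Z X Y Q W (f : mor X Y) (p : mor Y Q) (g : mor (Z ⊗ Y) W) :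
  is_cokernel f p -> g ∘ (idm Z ⊠ f) = 0 -> exists h, h ∘ (idm Z ⊠ p) = g.
Proof.
have [_ [D [ev [coev [_ zz]]]]] := @fus_rigid k C Z.
exact: (wl_desc_aux fus_wl0 zz).
Qed.

Lemma wr_desc Z X Y Q W (f : mor X Y) (p : mor Y Q) (g : mor (Y ⊗ Z) W) :
  is_cokernel f p -> g ∘ (f ⊠ idm Z) = 0 -> exists h, h ∘ (p ⊠ idm Z) = g.
Proof.
have [[D [ev [coev [zz _]]]] _] := @fus_rigid k C Z.
exact: (@wl_desc_aux k C (rev_monoidal (fus_mon C)) fus_wr0 D Z ev coev zz).
Qed.

End FusionExactness.

Section BimoduleTensor.
Context (k : fieldType) (C : fusion_category k) (A : algebra (fus_mon C)).
Implicit Types M N P Q : bimodule A.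

Lemma lactAt M V (x : mor V _) :
  lact M ∘ (amul A ⊠ idm M) ∘ x = lact M ∘ (idm A ⊠ lact M) ∘ assoc A A M ∘ x.
Proof. by rewrite compA lactA -!compA. Qed.

Lemma ractAt M V (x : mor V _) :
  ract M ∘ (ract M ⊠ idm A) ∘ x = ract M ∘ (idm M ⊠ amul A) ∘ assoc M A A ∘ x.
Proof. by rewrite compA -ractA -!compA. Qed.

Lemma lractAt M V (x : mor V _) :
  ract M ∘ (lact M ⊠ idm A) ∘ x = lact M ∘ (idm A ⊠ ract M) ∘ assoc A M A ∘ x.
Proof. by rewrite compA lractA -!compA. Qed.

Definition bal_diff M N : mor ((M ⊗ A) ⊗ N) (M ⊗ N) :=
  ract M ⊠ idm N - (idm M ⊠ lact N) ∘ assoc M A N.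

Definition tensA_ob M N : C := cok_ob (ab_coker (fus_abelian C) (bal_diff M N)).

Definition tensA_proj M N : mor (M ⊗ N) (tensA_ob M N) :=
  cok_proj (ab_coker (fus_abelian C) (bal_diff M N)).

Local Notation π := tensA_proj.

Lemma tensA_cok M N : is_cokernel (bal_diff M N) (π M N).
Proof. exact: cok_univ. Qed.

Lemma tensA_bal M N V (x : mor V _) :
  π M N ∘ (ract M ⊠ idm N) ∘ x = π M N ∘ (idm M ⊠ lact N) ∘ assoc M A N ∘ x.
Proof.
have [e _] := tensA_cok M N; rewrite compA [in RHS]compA [in RHS]compA.
congr (_ ∘ x); rewrite -compA; apply/eqP; rewrite -subr_eq0 -compmB.
exact/eqP.
Qed.

Lemma tensA_epi M N : epi (π M N).
Proof.
move=> W a b e; have [z up] := tensA_cok M N.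
have [|h [_ uh]] := up W (b ∘ π M N); first by rewrite -compA z compm0.
by rewrite -(uh a) ?(uh b).
Qed.

Lemma tensA_desc_ex M N W (g : mor (M ⊗ N) W) :
  (forall V (x : mor V _),
    g ∘ (ract M ⊠ idm N) ∘ x = g ∘ (idm M ⊠ lact N) ∘ assoc M A N ∘ x) ->
  exists h, h ∘ π M N = g.
Proof.
move=> e; have [_ up] := tensA_cok M N; have [|h [eh _]] := up W g.
  rewrite /bal_diff compmB; apply/eqP; rewrite subr_eq0; apply/eqP.
  by apply: homext => V x; rewrite -!compA e.
by exists h.
Qed.

Lemma wl_desc_ex Z M N W (g : mor (Z ⊗ (M ⊗ N)) W) :
  (forall V (x : mor V _),
    g ∘ (idm Z ⊠ (ract M ⊠ idm N)) ∘ x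
    = g ∘ (idm Z ⊠ (idm M ⊠ lact N)) ∘ (idm Z ⊠ assoc M A N) ∘ x) ->
  exists h, h ∘ (idm Z ⊠ π M N) = g.
Proof.
move=> e; apply: wl_desc (tensA_cok M N) _.
rewrite /bal_diff fus_wlB compmB; apply/eqP; rewrite subr_eq0; apply/eqP.
by apply: homext => V x; rewrite wlM0 -!compA e.
Qed.

Lemma wr_desc_ex Z M N W (g : mor ((M ⊗ N) ⊗ Z) W) :
  (forall V (x : mor V _),
    g ∘ ((ract M ⊠ idm N) ⊠ idm Z) ∘ x
    = g ∘ ((idm M ⊠ lact N) ⊠ idm Z) ∘ (assoc M A N ⊠ idm Z) ∘ x) ->
  exists h, h ∘ (π M N ⊠ idm Z) = g.
Proof.
move=> e; apply: wr_desc (tensA_cok M N) _.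
rewrite /bal_diff fus_wrB compmB; apply/eqP; rewrite subr_eq0; apply/eqP.
by apply: homext => V x; rewrite wrM0 -!compA e.
Qed.

Lemma tensA_lact_ex M N : exists h : mor (A ⊗ tensA_ob M N) (tensA_ob M N),
  h ∘ (idm A ⊠ π M N) = π M N ∘ (lact M ⊠ idm N) ∘ associ A M N.
Proof.
apply: wl_desc_ex => V x; rewrite -!compA associ2 associ3 -(wswap (lact M)).
rewrite -pentagon_a -!assoc1 -tensA_bal -!wrM; congr (_ ∘ _ ∘ _).
congr (_ ⊠ _); apply: homext => U y.
by rewrite -!compA lractAt associKt.
Qed.

Lemma tensA_ract_ex M N : exists h : mor (tensA_ob M N ⊗ A) (tensA_ob M N),
  h ∘ (π M N ⊠ idm A) = π M N ∘ (idm M ⊠ ract N) ∘ assoc M N A.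
Proof.
apply: wr_desc_ex => V x; rewrite -!compA assoc1 assoc2 wswap tensA_bal.
rewrite assoc3 pentagont -!wlM; congr (_ ∘ _ ∘ _); congr (_ ⊠ _).
by apply: homext => U y; rewrite -!compA lractAt.
Qed.

(* The induced actions are characterized by [tensA_lactE] and [tensA_ractE]. *)
Definition tensA_lact M N := projT1 (cid (tensA_lact_ex M N)).
Definition tensA_ract M N := projT1 (cid (tensA_ract_ex M N)).

Lemma tensA_lactE M N V (x : mor V _) :
  tensA_lact M N ∘ (idm A ⊠ π M N) ∘ x
  = π M N ∘ (lact M ⊠ idm N) ∘ associ A M N ∘ x.
Proof.
by rewrite compA (projT2 (cid (tensA_lact_ex M N))) -!compA.
Qed.

Lemma tensA_ractE M N V (x : mor V _) :
  tensA_ract M N ∘ (π M N ⊠ idm A) ∘ x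
  = π M N ∘ (idm M ⊠ ract N) ∘ assoc M N A ∘ x.
Proof.
by rewrite compA (projT2 (cid (tensA_ract_ex M N))) -!compA.
Qed.

Lemma tensA_lactA M N :
  tensA_lact M N ∘ (amul A ⊠ idm (tensA_ob M N))
  = tensA_lact M N ∘ (idm A ⊠ tensA_lact M N) ∘ assoc A A (tensA_ob M N).
Proof.
apply: (wl_epi (@tensA_epi M N)); apply: homext => V x; rewrite -!compA.
rewrite -wswap tensA_lactE assoc3 associ1 -wrM lactA.
rewrite [(idm A ⊠ tensA_lact M N) ∘ _]compA -wlM0.
have -> : tensA_lact M N ∘ (idm A ⊠ π M N)
    = π M N ∘ (lact M ⊠ idm N) ∘ associ A M N.
  by apply: homext => U y; rewrite -!compA tensA_lactE.
rewrite !wlM tensA_lactE associ2 pentagon_d.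
by rewrite -!wrM -!compA.
Qed.

Lemma tensA_lact1 M N :
  tensA_lact M N ∘ (aone A ⊠ idm (tensA_ob M N)) = lunit (tensA_ob M N).
Proof.
apply: (wl_epi (@tensA_epi M N)); apply: homext => V x; rewrite -!compA.
rewrite -wswap tensA_lactE associ1 -wrM lact1 lunit_tensi.
by rewrite lunit_natt.
Qed.

Lemma tensA_ractA M N :
  tensA_ract M N ∘ (idm (tensA_ob M N) ⊠ amul A) ∘ assoc (tensA_ob M N) A A
  = tensA_ract M N ∘ (tensA_ract M N ⊠ idm A).
Proof.
apply: (wr_epi (wr_epi (@tensA_epi M N))).
apply: homext => V x; rewrite -!compA.
rewrite assoc1 wswap tensA_ractE assoc3 pentagont.
rewrite -[in RHS]wrM.
have -> : tensA_ract M N ∘ (π M N ⊠ idm A)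
    = π M N ∘ (idm M ⊠ ract N) ∘ assoc M N A.
  by apply: homext => U y; rewrite -!compA tensA_ractE.
rewrite !wrM tensA_ractE assoc2 -!wlM; congr (_ ∘ _ ∘ _); congr (_ ⊠ _).
by rewrite -!compA ractA.
Qed.

Lemma tensA_ract1 M N :
  tensA_ract M N ∘ (idm (tensA_ob M N) ⊠ aone A) = runit (tensA_ob M N).
Proof.
apply: (wr_epi (@tensA_epi M N)); apply: homext => V x; rewrite -!compA.
rewrite wswap tensA_ractE assoc3 -wlM ract1 runit_tenst.
by rewrite runit_natt.
Qed.

Lemma tensA_lractA M N :
  tensA_ract M N ∘ (tensA_lact M N ⊠ idm A)
  = tensA_lact M N ∘ (idm A ⊠ tensA_ract M N) ∘ assoc A (tensA_ob M N) A.
Proof.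
apply: (wr_epi (wl_epi (@tensA_epi M N))).
apply: homext => V x; rewrite -!compA.
rewrite assoc2 -[in LHS]wrM -[in RHS]wlM.
have -> : tensA_ract M N ∘ (π M N ⊠ idm A)
    = π M N ∘ (idm M ⊠ ract N) ∘ assoc M N A.
  by apply: homext => U y; rewrite -!compA tensA_ractE.
have -> : tensA_lact M N ∘ (idm A ⊠ π M N)
    = π M N ∘ (lact M ⊠ idm N) ∘ associ A M N.
  by apply: homext => U y; rewrite -!compA tensA_lactE.
rewrite !wrM !wlM tensA_ractE tensA_lactE assoc1 associ3 pentagon_c assocKt.
by rewrite wswap.
Qed.

Definition tensA M N : bimodule A :=
  Bimodule (tensA_lactA M N) (tensA_lact1 M N) (tensA_ractA M N)
    (tensA_ract1 M N) (tensA_lractA M N).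

Lemma bhom_lt M N (f : bimodule_hom M N) V (x : mor V _) :
  f ∘ lact M ∘ x = lact N ∘ (idm A ⊠ f) ∘ x.
Proof. by rewrite compA bhom_l -compA. Qed.

Lemma bhom_rt M N (f : bimodule_hom M N) V (x : mor V _) :
  f ∘ ract M ∘ x = ract N ∘ (f ⊠ idm A) ∘ x.
Proof. by rewrite compA bhom_r -compA. Qed.

Section TensorMorphism.
Context (M M' N N' : bimodule A).
Context (f : bimodule_hom M M') (g : bimodule_hom N N').

Lemma tensAm_ex : exists h : mor (tensA_ob M N) (tensA_ob M' N'),
  h ∘ π M N = π M' N' ∘ (f ⊠ g).
Proof.
apply: tensA_desc_ex => V x; rewrite tensm_split -!compA.
rewrite wswap -[in LHS]wrM bhom_r wrM tensA_bal assoc1 wswap.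
by rewrite assoc3 -!wlM -bhom_l.
Qed.

Definition tensAm_hom := projT1 (cid tensAm_ex).

Lemma tensAm_homE V (x : mor V _) :
  tensAm_hom ∘ π M N ∘ x = π M' N' ∘ (f ⊠ g) ∘ x.
Proof. by rewrite compA (projT2 (cid tensAm_ex)) -!compA. Qed.

Lemma tensAm_l :
  tensAm_hom ∘ lact (tensA M N) = lact (tensA M' N') ∘ (idm A ⊠ tensAm_hom).
Proof.
apply: (wl_epi (@tensA_epi M N)); apply: homext => V x; rewrite -!compA /=.
rewrite tensA_lactE tensAm_homE -wlM.
have -> : tensAm_hom ∘ π M N = π M' N' ∘ (f ⊠ g).
  by apply: homext => U y; rewrite -!compA tensAm_homE.
rewrite wlM tensA_lactE tensm_split wlM -!compA.
by rewrite associ2 associ3 -!wswap -!wrM bhom_l.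
Qed.

Lemma tensAm_r :
  tensAm_hom ∘ ract (tensA M N) = ract (tensA M' N') ∘ (tensAm_hom ⊠ idm A).
Proof.
apply: (wr_epi (@tensA_epi M N)); apply: homext => V x; rewrite -!compA /=.
rewrite tensA_ractE tensAm_homE -[in RHS]wrM.
have -> : tensAm_hom ∘ π M N = π M' N' ∘ (f ⊠ g).
  by apply: homext => U y; rewrite -!compA tensAm_homE.
rewrite wrM tensA_ractE tensm_split wrM -!compA.
by rewrite assoc1 assoc2 wswap -!wlM bhom_r.
Qed.

Definition tensAm : bimodule_hom (tensA M N) (tensA M' N') :=
  @BimoduleHom _ _ A (tensA M N) (tensA M' N') tensAm_hom tensAm_l tensAm_r.

End TensorMorphism.

(* From here on the target of the projection is seen as a bimodule. *)

Definition projA M N : mor (M ⊗ N) (tensA M N) := tensA_proj M N.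

Local Notation ϖ := projA.

Lemma projA_epi M N : epi (ϖ M N).
Proof. exact: tensA_epi. Qed.

Lemma projA_bal M N V (x : mor V _) :
  ϖ M N ∘ (ract M ⊠ idm N) ∘ x = ϖ M N ∘ (idm M ⊠ lact N) ∘ assoc M A N ∘ x.
Proof. exact: tensA_bal. Qed.

Lemma projA_bali M N V (x : mor V _) :
  ϖ M N ∘ (ract M ⊠ idm N) ∘ associ M A N ∘ x = ϖ M N ∘ (idm M ⊠ lact N) ∘ x.
Proof. by rewrite projA_bal associKt. Qed.

Lemma projA_lact M N V (x : mor V _) :
  lact (tensA M N) ∘ (idm A ⊠ ϖ M N) ∘ x
  = ϖ M N ∘ (lact M ⊠ idm N) ∘ associ A M N ∘ x.
Proof. exact: tensA_lactE. Qed.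

Lemma projA_ract M N V (x : mor V _) :
  ract (tensA M N) ∘ (ϖ M N ⊠ idm A) ∘ x
  = ϖ M N ∘ (idm M ⊠ ract N) ∘ assoc M N A ∘ x.
Proof. exact: tensA_ractE. Qed.

Lemma projA_lactw Z M N V (x : mor V _) :
  (idm Z ⊠ lact (tensA M N)) ∘ (idm Z ⊠ (idm A ⊠ ϖ M N)) ∘ x
  = (idm Z ⊠ ϖ M N) ∘ (idm Z ⊠ (lact M ⊠ idm N)) ∘ (idm Z ⊠ associ A M N) ∘ x.
Proof.
rewrite -!wlM; congr ((_ ⊠ _) ∘ _); apply: homext => U y.
by rewrite -!compA projA_lact.
Qed.

Lemma projA_lactw' Z M N V (x : mor V _) :
  (lact (tensA M N) ⊠ idm Z) ∘ ((idm A ⊠ ϖ M N) ⊠ idm Z) ∘ x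
  = (ϖ M N ⊠ idm Z) ∘ ((lact M ⊠ idm N) ⊠ idm Z) ∘ (associ A M N ⊠ idm Z) ∘ x.
Proof.
rewrite -!wrM; congr ((_ ⊠ _) ∘ _); apply: homext => U y.
by rewrite -!compA projA_lact.
Qed.

Lemma projA_ractw' Z M N V (x : mor V _) :
  (idm Z ⊠ ract (tensA M N)) ∘ (idm Z ⊠ (ϖ M N ⊠ idm A)) ∘ x
  = (idm Z ⊠ ϖ M N) ∘ (idm Z ⊠ (idm M ⊠ ract N)) ∘ (idm Z ⊠ assoc M N A) ∘ x.
Proof.
rewrite -!wlM; congr ((_ ⊠ _) ∘ _); apply: homext => U y.
by rewrite -!compA projA_ract.
Qed.

Lemma projA_ractw Z M N V (x : mor V _) :
  (ract (tensA M N) ⊠ idm Z) ∘ ((ϖ M N ⊠ idm A) ⊠ idm Z) ∘ x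
  = (ϖ M N ⊠ idm Z) ∘ ((idm M ⊠ ract N) ⊠ idm Z) ∘ (assoc M N A ⊠ idm Z) ∘ x.
Proof.
rewrite -!wrM; congr ((_ ⊠ _) ∘ _); apply: homext => U y.
by rewrite -!compA projA_ract.
Qed.

Lemma projA_balw Z M N V (x : mor V _) :
  (idm Z ⊠ ϖ M N) ∘ (idm Z ⊠ (ract M ⊠ idm N)) ∘ x
  = (idm Z ⊠ ϖ M N) ∘ (idm Z ⊠ (idm M ⊠ lact N)) ∘ (idm Z ⊠ assoc M A N) ∘ x.
Proof.
rewrite -!wlM; congr ((_ ⊠ _) ∘ _); apply: homext => U y.
by rewrite -!compA projA_bal.
Qed.

Lemma projA_balw' Z M N V (x : mor V _) :
  (ϖ M N ⊠ idm Z) ∘ ((ract M ⊠ idm N) ⊠ idm Z) ∘ x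
  = (ϖ M N ⊠ idm Z) ∘ ((idm M ⊠ lact N) ⊠ idm Z) ∘ (assoc M A N ⊠ idm Z) ∘ x.
Proof.
rewrite -!wrM; congr ((_ ⊠ _) ∘ _); apply: homext => U y.
by rewrite -!compA projA_bal.
Qed.

Lemma projA_desc M N W (g : mor (M ⊗ N) W) :
  (forall V (x : mor V _),
    g ∘ (ract M ⊠ idm N) ∘ x = g ∘ (idm M ⊠ lact N) ∘ assoc M A N ∘ x) ->
  {h : mor (tensA M N : C) W | h ∘ ϖ M N = g}.
Proof. by move=> e; apply: cid; apply: tensA_desc_ex. Qed.

Lemma projA_wl_desc Z M N W (g : mor (Z ⊗ (M ⊗ N)) W) :
  (forall V (x : mor V _),
    g ∘ (idm Z ⊠ (ract M ⊠ idm N)) ∘ x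
    = g ∘ (idm Z ⊠ (idm M ⊠ lact N)) ∘ (idm Z ⊠ assoc M A N) ∘ x) ->
  {h : mor (Z ⊗ tensA M N) W | h ∘ (idm Z ⊠ ϖ M N) = g}.
Proof. by move=> e; apply: cid; apply: wl_desc_ex. Qed.

Lemma projA_wr_desc Z M N W (g : mor ((M ⊗ N) ⊗ Z) W) :
  (forall V (x : mor V _),
    g ∘ ((ract M ⊠ idm N) ⊠ idm Z) ∘ x
    = g ∘ ((idm M ⊠ lact N) ⊠ idm Z) ∘ (assoc M A N ⊠ idm Z) ∘ x) ->
  {h : mor (tensA M N ⊗ Z) W | h ∘ (ϖ M N ⊠ idm Z) = g}.
Proof. by move=> e; apply: cid; apply: wr_desc_ex. Qed.

Lemma projA_mor M M' N N' (f : bimodule_hom M M') (g : bimodule_hom N N')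
    V (x : mor V _) :
  tensAm f g ∘ ϖ M N ∘ x = ϖ M' N' ∘ (f ⊠ g) ∘ x.
Proof. exact: tensAm_homE. Qed.

Lemma projA_morr M M' N N' (f : bimodule_hom M M') (g : bimodule_hom N N')
    (Z Z' : C) (h : mor Z Z') V (x : mor V _) :
  (tensAm f g ⊠ h) ∘ (ϖ M N ⊠ idm Z) ∘ x = (ϖ M' N' ⊠ idm Z') ∘ ((f ⊠ g) ⊠ h) ∘ x.
Proof.
rewrite !compA -!tensmM comp1m compm1; congr ((_ ⊠ _) ∘ _).
by apply: homext => U y; rewrite -!compA projA_mor.
Qed.

Lemma projA_morl M M' N N' (f : bimodule_hom M M') (g : bimodule_hom N N')
    (Z Z' : C) (h : mor Z Z') V (x : mor V _) :
  (h ⊠ tensAm f g) ∘ (idm Z ⊠ ϖ M N) ∘ x = (idm Z' ⊠ ϖ M' N') ∘ (h ⊠ (f ⊠ g)) ∘ x.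
Proof.
rewrite !compA -!tensmM comp1m compm1; congr ((_ ⊠ _) ∘ _).
by apply: homext => U y; rewrite -!compA projA_mor.
Qed.

Section Associator.
Context (M N P : bimodule A).

Lemma assocA_ex : {h : mor (tensA (tensA M N) P : C) (tensA M (tensA N P)) |
  h ∘ ϖ (tensA M N) P ∘ (ϖ M N ⊠ idm P)
  = ϖ M (tensA N P) ∘ (idm M ⊠ ϖ N P) ∘ assoc M N P}.
Proof.
have [|g eg] := @projA_wr_desc P M N _
    (ϖ M (tensA N P) ∘ (idm M ⊠ ϖ N P) ∘ assoc M N P).
  move=> V x; rewrite -!compA assoc1 assoc2 wswap projA_bal.
  rewrite assoc3 projA_lactw pentagont.
  by rewrite (wl_cancel (assocK _ _ _)).
have {}eg V (x : mor V _) : g ∘ (ϖ M N ⊠ idm P) ∘ x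
    = ϖ M (tensA N P) ∘ (idm M ⊠ ϖ N P) ∘ assoc M N P ∘ x.
  by rewrite compA eg -!compA.
have [|h eh] := @projA_desc (tensA M N) P _ g.
  suff e : g ∘ (ract (tensA M N) ⊠ idm P)
      = g ∘ (idm (tensA M N : C) ⊠ lact P) ∘ assoc (tensA M N) A P.
    by move=> V x; rewrite compA e -!compA.
  apply: (wr_epi (wr_epi (@projA_epi M N))); apply: homext => V x.
  rewrite -!compA projA_ractw eg assoc2 projA_balw.
  rewrite assoc1 wswap eg assoc3.
  by rewrite pentagont.
by exists h; apply: homext => V x; rewrite -!compA [h ∘ _]compA eh eg.
Qed.

Lemma associA_ex : {h : mor (tensA M (tensA N P) : C) (tensA (tensA M N) P) |
  h ∘ ϖ M (tensA N P) ∘ (idm M ⊠ ϖ N P)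
  = ϖ (tensA M N) P ∘ (ϖ M N ⊠ idm P) ∘ associ M N P}.
Proof.
have [|g eg] := @projA_wl_desc M N P _
    (ϖ (tensA M N) P ∘ (ϖ M N ⊠ idm P) ∘ associ M N P).
  move=> V x; rewrite -!compA associ2 associ3 -wswap -projA_bali.
  rewrite associ1 projA_ractw.
  rewrite pentagon_b (wl_cancel (assocK _ _ _)).
  by rewrite (wr_cancel (associK _ _ _)).
have {}eg V (x : mor V _) : g ∘ (idm M ⊠ ϖ N P) ∘ x
    = ϖ (tensA M N) P ∘ (ϖ M N ⊠ idm P) ∘ associ M N P ∘ x.
  by rewrite compA eg -!compA.
have [|h eh] := @projA_desc M (tensA N P) _ g.
  suff e : g ∘ (ract M ⊠ idm (tensA N P : C))
      = g ∘ (idm M ⊠ lact (tensA N P)) ∘ assoc M A (tensA N P).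
    by move=> V x; rewrite compA e -!compA.
  apply: (wl_epi (@projA_epi N P)); apply: homext => V x.
  rewrite -!compA -wswap eg associ1 projA_balw'.
  rewrite assoc3 projA_lactw eg associ2.
  by rewrite pentagon_d.
by exists h; apply: homext => V x; rewrite -!compA [h ∘ _]compA eh eg.
Qed.

(* The associativity constraint is characterized by [assocA_homE], and the
   unit constraints below by [lunitA_homE] and [runitA_homE]. *)
Definition assocA_hom := projT1 assocA_ex.
Definition associA_hom := projT1 associA_ex.

Lemma assocA_homE V (x : mor V _) :
  assocA_hom ∘ ϖ (tensA M N) P ∘ (ϖ M N ⊠ idm P) ∘ x
  = ϖ M (tensA N P) ∘ (idm M ⊠ ϖ N P) ∘ assoc M N P ∘ x.
Proof. by have := tail (projT2 assocA_ex) x; rewrite -!compA. Qed.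

Lemma associA_homE V (x : mor V _) :
  associA_hom ∘ ϖ M (tensA N P) ∘ (idm M ⊠ ϖ N P) ∘ x
  = ϖ (tensA M N) P ∘ (ϖ M N ⊠ idm P) ∘ associ M N P ∘ x.
Proof. by have := tail (projT2 associA_ex) x; rewrite -!compA. Qed.

Lemma assocA_homK : associA_hom ∘ assocA_hom = idm (tensA (tensA M N) P : C).
Proof.
apply: (@projA_epi (tensA M N) P); apply: (wr_epi (@projA_epi M N)).
apply: homext => V x; rewrite -!compA assocA_homE associA_homE assocKt.
by rewrite comp1m.
Qed.

Lemma associA_homK : assocA_hom ∘ associA_hom = idm (tensA M (tensA N P) : C).
Proof.
apply: (@projA_epi M (tensA N P)); apply: (wl_epi (@projA_epi N P)).
apply: homext => V x; rewrite -!compA associA_homE assocA_homE associKt.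
by rewrite comp1m.
Qed.

Lemma assocA_homEl Z V (x : mor V _) :
  (idm Z ⊠ assocA_hom) ∘ (idm Z ⊠ ϖ (tensA M N) P)
    ∘ (idm Z ⊠ (ϖ M N ⊠ idm P)) ∘ x
  = (idm Z ⊠ ϖ M (tensA N P)) ∘ (idm Z ⊠ (idm M ⊠ ϖ N P))
    ∘ (idm Z ⊠ assoc M N P) ∘ x.
Proof.
rewrite -!wlM; congr ((_ ⊠ _) ∘ _); apply: homext => U y.
by rewrite -!compA assocA_homE.
Qed.

Lemma assocA_homEr Z V (x : mor V _) :
  (assocA_hom ⊠ idm Z) ∘ (ϖ (tensA M N) P ⊠ idm Z)
    ∘ ((ϖ M N ⊠ idm P) ⊠ idm Z) ∘ x
  = (ϖ M (tensA N P) ⊠ idm Z) ∘ ((idm M ⊠ ϖ N P) ⊠ idm Z)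
    ∘ (assoc M N P ⊠ idm Z) ∘ x.
Proof.
rewrite -!wrM; congr ((_ ⊠ _) ∘ _); apply: homext => U y.
by rewrite -!compA assocA_homE.
Qed.

Lemma assocA_l :
  assocA_hom ∘ lact (tensA (tensA M N) P)
  = lact (tensA M (tensA N P)) ∘ (idm A ⊠ assocA_hom).
Proof.
apply: (wl_epi (@projA_epi (tensA M N) P)).
apply: (wl_epi (wr_epi (@projA_epi M N))).
apply: homext => V x; rewrite -!compA.
rewrite projA_lact associ2 projA_lactw' assocA_homE assoc1 pentagon_a.
by rewrite assocA_homEl projA_lact associ3 wswap.
Qed.

Lemma assocA_r :
  assocA_hom ∘ ract (tensA (tensA M N) P)
  = ract (tensA M (tensA N P)) ∘ (assocA_hom ⊠ idm A).
Proof.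
apply: (wr_epi (@projA_epi (tensA M N) P)).
apply: (wr_epi (wr_epi (@projA_epi M N))).
apply: homext => V x; rewrite -!compA.
rewrite projA_ract assoc1 wswap assocA_homE assoc3 pentagont.
by rewrite assocA_homEr projA_ract assoc2 projA_ractw'.
Qed.

End Associator.

Lemma bhom_inv M N (f : bimodule_hom M N) (g : mor (N : C) M) :
  g ∘ f = idm (M : C) -> f ∘ g = idm (N : C) ->
  g ∘ lact N = lact M ∘ (idm A ⊠ g) /\ g ∘ ract N = ract M ∘ (g ⊠ idm A).
Proof.
move=> gf fg; split.
- rewrite -[lact N]compm1 -tensm1 -fg wlM0 [lact N ∘ _]compA -bhom_l -!compA.
  by rewrite [g ∘ _]compA gf comp1m.
- rewrite -[ract N]compm1 -tensm1 -fg wrM0 [ract N ∘ _]compA -bhom_r -!compA.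
  by rewrite [g ∘ _]compA gf comp1m.
Qed.

Definition assocA M N P :
    bimodule_hom (tensA (tensA M N) P) (tensA M (tensA N P)) :=
  BimoduleHom (assocA_l M N P) (assocA_r M N P).

Lemma associA_lr M N P :
  associA_hom M N P ∘ lact (tensA M (tensA N P))
    = lact (tensA (tensA M N) P) ∘ (idm A ⊠ associA_hom M N P)
  /\ associA_hom M N P ∘ ract (tensA M (tensA N P))
    = ract (tensA (tensA M N) P) ∘ (associA_hom M N P ⊠ idm A).
Proof.
exact: (@bhom_inv _ _ (assocA M N P) _ (assocA_homK M N P) (associA_homK M N P)).
Qed.

Definition associA M N P :
    bimodule_hom (tensA M (tensA N P)) (tensA (tensA M N) P) :=
  BimoduleHom (proj1 (associA_lr M N P)) (proj2 (associA_lr M N P)).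

Definition regular : bimodule A :=
  @Bimodule _ _ A A (amul A) (amul A) (amulA A) (amul1l A)
    (esym (amulA A)) (amul1r A) (amulA A).

Section Unitors.
Context (M : bimodule A).

Lemma lunitA_ex : {h : mor (tensA regular M : C) M | h ∘ ϖ regular M = lact M}.
Proof. by apply: projA_desc => V x; rewrite lactAt. Qed.

Lemma runitA_ex : {h : mor (tensA M regular : C) M | h ∘ ϖ M regular = ract M}.
Proof. by apply: projA_desc => V x; rewrite ractAt. Qed.

Definition lunitA_hom := projT1 lunitA_ex.
Definition runitA_hom := projT1 runitA_ex.

Lemma lunitA_homE V (x : mor V _) :
  lunitA_hom ∘ ϖ regular M ∘ x = lact M ∘ x.
Proof. by rewrite compA (projT2 lunitA_ex). Qed.

Lemma runitA_homE V (x : mor V _) :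
  runitA_hom ∘ ϖ M regular ∘ x = ract M ∘ x.
Proof. by rewrite compA (projT2 runitA_ex). Qed.

Definition lunitiA_hom : mor (M : C) (tensA regular M) :=
  ϖ regular M ∘ (aone A ⊠ idm M) ∘ luniti M.

Definition runitiA_hom : mor (M : C) (tensA M regular) :=
  ϖ M regular ∘ (idm M ⊠ aone A) ∘ runiti M.

Lemma lunitA_homK : lunitiA_hom ∘ lunitA_hom = idm (tensA regular M : C).
Proof.
apply: (@projA_epi regular M); apply: homext => V x.
rewrite /lunitiA_hom -!compA lunitA_homE -luniti_natt -wswap.
rewrite -projA_bali associ1 -wrM amul1l lunit_tensi.
by rewrite lunitiKt comp1m.
Qed.

Lemma lunitiA_homK : lunitA_hom ∘ lunitiA_hom = idm (M : C).
Proof.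
apply: homext => V x; rewrite /lunitiA_hom -!compA lunitA_homE.
by rewrite [lact M ∘ _]compA lact1 lunitiKt comp1m.
Qed.

Lemma runitA_homK : runitiA_hom ∘ runitA_hom = idm (tensA M regular : C).
Proof.
apply: (@projA_epi M regular); apply: homext => V x.
rewrite /runitiA_hom -!compA runitA_homE -runiti_natt wswap.
rewrite projA_bal assoc3 -wlM amul1r runit_tenst.
by rewrite runitiKt comp1m.
Qed.

Lemma runitiA_homK : runitA_hom ∘ runitiA_hom = idm (M : C).
Proof.
apply: homext => V x; rewrite /runitiA_hom -!compA runitA_homE.
by rewrite [ract M ∘ _]compA ract1 runitiKt comp1m.
Qed.

Lemma lunitA_l : lunitA_hom ∘ lact (tensA regular M) = lact M ∘ (idm A ⊠ lunitA_hom).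
Proof.
apply: (wl_epi (@projA_epi regular M)); apply: homext => V x; rewrite -!compA.
rewrite projA_lact lunitA_homE -wlM (projT2 lunitA_ex).
by rewrite lactAt associKt.
Qed.

Lemma lunitA_r : lunitA_hom ∘ ract (tensA regular M) = ract M ∘ (lunitA_hom ⊠ idm A).
Proof.
apply: (wr_epi (@projA_epi regular M)); apply: homext => V x; rewrite -!compA.
rewrite projA_ract lunitA_homE -[in RHS]wrM (projT2 lunitA_ex).
by rewrite lractAt.
Qed.

Lemma runitA_l : runitA_hom ∘ lact (tensA M regular) = lact M ∘ (idm A ⊠ runitA_hom).
Proof.
apply: (wl_epi (@projA_epi M regular)); apply: homext => V x; rewrite -!compA.
rewrite projA_lact runitA_homE -wlM (projT2 runitA_ex).
by rewrite lractAt associKt.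
Qed.

Lemma runitA_r : runitA_hom ∘ ract (tensA M regular) = ract M ∘ (runitA_hom ⊠ idm A).
Proof.
apply: (wr_epi (@projA_epi M regular)); apply: homext => V x; rewrite -!compA.
rewrite projA_ract runitA_homE -[in RHS]wrM (projT2 runitA_ex).
by rewrite ractAt.
Qed.

Definition lunitA : bimodule_hom (tensA regular M) M :=
  BimoduleHom lunitA_l lunitA_r.

Definition runitA : bimodule_hom (tensA M regular) M :=
  BimoduleHom runitA_l runitA_r.

Lemma lunitiA_lr :
  lunitiA_hom ∘ lact M = lact (tensA regular M) ∘ (idm A ⊠ lunitiA_hom)
  /\ lunitiA_hom ∘ ract M = ract (tensA regular M) ∘ (lunitiA_hom ⊠ idm A).
Proof. exact: (@bhom_inv _ _ lunitA _ lunitA_homK lunitiA_homK). Qed.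

Lemma runitiA_lr :
  runitiA_hom ∘ lact M = lact (tensA M regular) ∘ (idm A ⊠ runitiA_hom)
  /\ runitiA_hom ∘ ract M = ract (tensA M regular) ∘ (runitiA_hom ⊠ idm A).
Proof. exact: (@bhom_inv _ _ runitA _ runitA_homK runitiA_homK). Qed.

Definition lunitiA : bimodule_hom M (tensA regular M) :=
  BimoduleHom (proj1 lunitiA_lr) (proj2 lunitiA_lr).

Definition runitiA : bimodule_hom M (tensA M regular) :=
  BimoduleHom (proj1 runitiA_lr) (proj2 runitiA_lr).

End Unitors.

Lemma tensAm1 M N :
  tensAm (bimodule_id M) (bimodule_id N) = bimodule_id (tensA M N).
Proof.
apply: bhom_inj; apply: (@projA_epi M N); apply: homext => V x.
by rewrite -!compA projA_mor tensm1 !comp1m.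
Qed.

Lemma tensAmM M M' M'' N N' N'' (f' : bimodule_hom M' M'')
    (f : bimodule_hom M M') (g' : bimodule_hom N' N'') (g : bimodule_hom N N') :
  tensAm (bimodule_comp f' f) (bimodule_comp g' g)
  = bimodule_comp (tensAm f' g') (tensAm f g).
Proof.
apply: bhom_inj; apply: (@projA_epi M N); apply: homext => V x.
by rewrite /= -!compA !projA_mor /= tensmM -!compA.
Qed.

Lemma assocA_nat M M' N N' P P' (f : bimodule_hom M M')
    (g : bimodule_hom N N') (h : bimodule_hom P P') :
  bimodule_comp (assocA M' N' P') (tensAm (tensAm f g) h)
  = bimodule_comp (tensAm f (tensAm g h)) (assocA M N P).
Proof.
apply: bhom_inj; apply: (@projA_epi (tensA M N) P).
apply: (wr_epi (@projA_epi M N)); apply: homext => V x; rewrite /= -!compA.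
rewrite projA_mor projA_morr !assocA_homE projA_mor projA_morl.
by rewrite [assoc _ _ _ ∘ _]compA assoc_nat -compA.
Qed.

Lemma lunitA_nat M M' (f : bimodule_hom M M') :
  bimodule_comp (lunitA M') (tensAm (bimodule_id regular) f)
  = bimodule_comp f (lunitA M).
Proof.
apply: bhom_inj; apply: (@projA_epi regular M).
apply: homext => V x; rewrite /= -!compA projA_mor !lunitA_homE.
by rewrite bhom_lt.
Qed.

Lemma runitA_nat M M' (f : bimodule_hom M M') :
  bimodule_comp (runitA M') (tensAm f (bimodule_id regular))
  = bimodule_comp f (runitA M).
Proof.
apply: bhom_inj; apply: (@projA_epi M regular).
apply: homext => V x; rewrite /= -!compA projA_mor !runitA_homE.
by rewrite bhom_rt.
Qed.

Lemma pentagonA M N P Q :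
  bimodule_comp (assocA M N (tensA P Q)) (assocA (tensA M N) P Q)
  = bimodule_comp (tensAm (bimodule_id M) (assocA N P Q))
      (bimodule_comp (assocA M (tensA N P) Q)
        (tensAm (assocA M N P) (bimodule_id Q))).
Proof.
apply: bhom_inj; apply: (@projA_epi (tensA (tensA M N) P) Q).
apply: (wr_epi (@projA_epi (tensA M N) P)).
apply: (wr_epi (wr_epi (@projA_epi M N))).
apply: homext => V x; rewrite /= -!compA.
rewrite assocA_homE assoc1 wswap assocA_homE assoc3 pentagont.
rewrite projA_mor assocA_homEr assocA_homE assoc2 projA_mor.
by rewrite assocA_homEl.
Qed.

Lemma triangleA M N :
  bimodule_comp (tensAm (bimodule_id M) (lunitA N)) (assocA M regular N)
  = tensAm (runitA M) (bimodule_id N).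
Proof.
apply: bhom_inj; apply: (@projA_epi (tensA M regular) N).
apply: (wr_epi (@projA_epi M regular)).
apply: homext => V x; rewrite /= -!compA assocA_homE !projA_mor /=.
rewrite -wlM -[in RHS]wrM (projT2 (lunitA_ex N)) (projT2 (runitA_ex M)).
by rewrite projA_bal.
Qed.

#[global] Instance bimodule_monoidal : monoidal (bimodule_category A).
Proof.
refine (@Monoidal (bimodule_category A) tensA (fun X X' Y Y' => @tensAm X X' Y Y')
  regular assocA associA lunitA lunitiA runitA runitiA
  tensAm1 tensAmM assocA_nat lunitA_nat runitA_nat _ _ _ _ _ _
  pentagonA triangleA).
- by move=> *; apply: bhom_inj; apply: assocA_homK.
- by move=> *; apply: bhom_inj; apply: associA_homK.
- by move=> *; apply: bhom_inj; apply: lunitA_homK.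
- by move=> *; apply: bhom_inj; apply: lunitiA_homK.
- by move=> *; apply: bhom_inj; apply: runitA_homK.
- by move=> *; apply: bhom_inj; apply: runitiA_homK.
Defined.

End BimoduleTensor.

Section FreeBimodule.
Context (C : category) (M : monoidal C) (A : algebra M).
Implicit Types X Y Z : C.

Lemma left_module_tensA Y Z (l : mor (A ⊗ Y) Y) :
  l ∘ (amul A ⊠ idm Y) = l ∘ (idm A ⊠ l) ∘ assoc A A Y ->
  ((l ⊠ idm Z) ∘ associ A Y Z) ∘ (amul A ⊠ idm (Y ⊗ Z))
  = ((l ⊠ idm Z) ∘ associ A Y Z) ∘ (idm A ⊠ ((l ⊠ idm Z) ∘ associ A Y Z))
      ∘ assoc A A (Y ⊗ Z).
Proof.
move=> e; apply: homext => V x; rewrite -!compA associ1 -wrM e.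
by rewrite wlM associ2 pentagon_d -!wrM -!compA.
Qed.

Lemma left_module_tens1 Y Z (l : mor (A ⊗ Y) Y) :
  l ∘ (aone A ⊠ idm Y) = lunit Y ->
  ((l ⊠ idm Z) ∘ associ A Y Z) ∘ (aone A ⊠ idm (Y ⊗ Z)) = lunit (Y ⊗ Z).
Proof.
move=> e; apply: homext => V x; rewrite -!compA associ1 -wrM e.
by rewrite lunit_tensi.
Qed.

Definition free_lact X : mor (A ⊗ ((A ⊗ X) ⊗ A)) ((A ⊗ X) ⊗ A) :=
  (((amul A ⊠ idm X) ∘ associ A A X) ⊠ idm A) ∘ associ A (A ⊗ X) A.

Definition free_ract X : mor (((A ⊗ X) ⊗ A) ⊗ A) ((A ⊗ X) ⊗ A) :=
  (idm (A ⊗ X) ⊠ amul A) ∘ assoc (A ⊗ X) A A.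

Lemma free_lactA X :
  free_lact X ∘ (amul A ⊠ idm ((A ⊗ X) ⊗ A))
  = free_lact X ∘ (idm A ⊠ free_lact X) ∘ assoc A A ((A ⊗ X) ⊗ A).
Proof. by apply/left_module_tensA/left_module_tensA/amulA. Qed.

Lemma free_lact1 X :
  free_lact X ∘ (aone A ⊠ idm ((A ⊗ X) ⊗ A)) = lunit ((A ⊗ X) ⊗ A).
Proof. by apply/left_module_tens1/left_module_tens1/amul1l. Qed.

Lemma free_ractA X :
  free_ract X ∘ (idm ((A ⊗ X) ⊗ A) ⊠ amul A) ∘ assoc ((A ⊗ X) ⊗ A) A A
  = free_ract X ∘ (free_ract X ⊠ idm A).
Proof.
apply: homext => V x; rewrite /free_ract -!compA assoc3 pentagont.
rewrite wrM assoc2 -!wlM; congr ((_ ⊠ _) ∘ _).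
by rewrite -!compA amulA.
Qed.

Lemma free_ract1 X :
  free_ract X ∘ (idm ((A ⊗ X) ⊗ A) ⊠ aone A) = runit ((A ⊗ X) ⊗ A).
Proof.
apply: homext => V x; rewrite /free_ract -!compA assoc3 -wlM amul1r.
by rewrite runit_tenst.
Qed.

Lemma free_lractA X :
  free_ract X ∘ (free_lact X ⊠ idm A)
  = free_lact X ∘ (idm A ⊠ free_ract X) ∘ assoc A ((A ⊗ X) ⊗ A) A.
Proof.
apply: homext => V x; rewrite /free_ract /free_lact.
move: ((amul A ⊠ idm X) ∘ associ A A X) => l.
rewrite -!compA wrM wlM assoc1 associ3 pentagon_c assocKt.
by rewrite wswap.
Qed.

Definition free_bimodule X : bimodule A :=
  Bimodule (free_lactA X) (free_lact1 X) (free_ractA X) (free_ract1 X)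
    (free_lractA X).

Section FreeMorphism.
Context (X Y : C) (f : mor X Y).

Lemma free_hom_l :
  ((idm A ⊠ f) ⊠ idm A) ∘ lact (free_bimodule X)
  = lact (free_bimodule Y) ∘ (idm A ⊠ ((idm A ⊠ f) ⊠ idm A)).
Proof.
apply: homext => V x; rewrite /= /free_lact -!compA associ2 -!wrM.
congr ((_ ⊠ _) ∘ _); apply: homext => U y.
by rewrite -!compA associ3 wswap.
Qed.

Lemma free_hom_r :
  ((idm A ⊠ f) ⊠ idm A) ∘ ract (free_bimodule X)
  = ract (free_bimodule Y) ∘ (((idm A ⊠ f) ⊠ idm A) ⊠ idm A).
Proof.
apply: homext => V x; rewrite /= /free_ract -!compA assoc1.
by rewrite wswap.
Qed.

Definition free_hom : bimodule_hom (free_bimodule X) (free_bimodule Y) :=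
  @BimoduleHom _ _ A (free_bimodule X) (free_bimodule Y)
    ((idm A ⊠ f) ⊠ idm A) free_hom_l free_hom_r.

End FreeMorphism.

Definition Phi : functor C (bimodule_category A).
Proof.
refine (@Functor C (bimodule_category A) free_bimodule free_hom _ _).
- by move=> X; apply: bhom_inj; rewrite /= !tensm1.
- by move=> X Y Z g f; apply: bhom_inj; rewrite /= wlM0 wrM0.
Defined.

End FreeBimodule.

Section PhiStructure.
Context (C : category) (M : monoidal C) (A : frobenius_algebra M).
Implicit Types X : C.

Definition Phi_assoc X X' :
    mor (((A ⊗ X) ⊗ A) ⊗ ((A ⊗ X') ⊗ A)) (((A ⊗ X) ⊗ ((A ⊗ A) ⊗ X')) ⊗ A) :=
  ((idm (A ⊗ X) ⊠ associ A A X') ⊠ idm A)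
  ∘ (assoc (A ⊗ X) A (A ⊗ X') ⊠ idm A)
  ∘ associ ((A ⊗ X) ⊗ A) (A ⊗ X') A.

Definition Phi_mult X X' :
    mor (((A ⊗ X) ⊗ A) ⊗ ((A ⊗ X') ⊗ A)) ((A ⊗ (X ⊗ X')) ⊗ A) :=
  (assoc A X X' ⊠ idm A)
  ∘ ((idm (A ⊗ X) ⊠ lunit X') ⊠ idm A)
  ∘ ((idm (A ⊗ X) ⊠ ((counit A ∘ amul A) ⊠ idm X')) ⊠ idm A)
  ∘ Phi_assoc X X'.

Definition Phi_unit : mor (A : C) ((A ⊗ munit) ⊗ A) :=
  (runiti A ⊠ idm A) ∘ comul A.

Definition Phi_associ X X' :
    mor (((A ⊗ X) ⊗ ((A ⊗ A) ⊗ X')) ⊗ A) (((A ⊗ X) ⊗ A) ⊗ ((A ⊗ X') ⊗ A)) :=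
  assoc ((A ⊗ X) ⊗ A) (A ⊗ X') A
  ∘ (associ (A ⊗ X) A (A ⊗ X') ⊠ idm A)
  ∘ ((idm (A ⊗ X) ⊠ assoc A A X') ⊠ idm A).

Definition Phi_comult X X' :
    mor ((A ⊗ (X ⊗ X')) ⊗ A) (((A ⊗ X) ⊗ A) ⊗ ((A ⊗ X') ⊗ A)) :=
  Phi_associ X X'
  ∘ ((idm (A ⊗ X) ⊠ ((comul A ∘ aone A) ⊠ idm X')) ⊠ idm A)
  ∘ ((idm (A ⊗ X) ⊠ luniti X') ⊠ idm A)
  ∘ (associ A X X' ⊠ idm A).

Definition Phi_counit : mor ((A ⊗ munit) ⊗ A) (A : C) :=
  amul A ∘ (runit A ⊠ idm A).

End PhiStructure.

(* Main.v *)
From Pilot Require Import Defs.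
From HB Require Import structures.
From mathcomp Require Import all_boot all_order all_algebra.
(* Restores the associativity law [compA] of Defs, shadowed by ssrfun's. *)
Import Pilot.Defs.
Set Implicit Arguments.
Unset Strict Implicit.
Unset Printing Implicit Defensive.
Local Open Scope ring_scope.
Local Open Scope cat_scope.

(** Every object X acts on C by X ⊗ -, and f : X -> Y acts by the natural maps
f ⊗ W; this representation is faithful, carries ⊗ to composition of functors
and all the constraints of C to identities. Read in this way, Phi_mult is the
nondegenerate pairing εm : A ⊗ A -> 1, and Phi_comult the copairing Δu, placed
between identities. Balancedness of Phi_mult is the invariance of the pairing;
the associativity, coassociativity and Frobenius relations of Phi, as well as
naturality, are instances of the interchange law. The unit laws for Phi_unit
are the identities (id ⊗ εm)(Δ ⊗ id) = m = (εm ⊗ id)(id ⊗ Δ), and the counit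
laws for Phi_counit reduce, by (m ⊗ id)(id ⊗ Δu) = Δ = (id ⊗ m)(Δu ⊗ id), to
mΔ = id, which is the only place where specialness enters. Since the
projections onto ⊗_A are epimorphisms preserved by tensoring, these relations
between the maps on ⊗ descend to ⊗_A. *)

(** * Objects as endofunctors of the category *)

Section Tensoring.
Context (C : category) (M : monoidal C).

(** The functor is only required to be isomorphic to [tens_ob ⊗ -], so that for a tensor product it
    can be a strict composite and for the unit object the identity. *)
Record tensoring := Tensoring {
  tens_ob :> C;
  tens_fun : functor C C;
  tens_iso : forall W, mor (tens_ob ⊗ W) (tens_fun W);
  tens_inv : forall W, mor (tens_fun W) (tens_ob ⊗ W);
  tens_isoK : forall W, tens_inv W ∘ tens_iso W = idm _;
  tens_invK : forall W, tens_iso W ∘ tens_inv W = idm _;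
  tens_iso_nat : forall W W' (f : mor W W'),
    tens_iso W' ∘ (idm tens_ob ⊠ f) = fmap tens_fun f ∘ tens_iso W }.

Definition comp_functor (F G : functor C C) : functor C C.
Proof.
refine (@Functor C C (fun W => F (G W)) (fun _ _ f => fmap F (fmap G f)) _ _).
- by move=> X; rewrite !fmap1.
- by move=> X Y Z g f; rewrite !fmapM.
Defined.

Definition tensl_functor (X : C) : functor C C.
Proof.
refine (@Functor C C (fun W => X ⊗ W) (fun _ _ f => idm X ⊠ f) _ _).
- by move=> W; apply: tensm1.
- by move=> *; apply: wlM0.
Defined.

Definition id_functor : functor C C :=
  @Functor C C id (fun _ _ => id) (fun _ => erefl) (fun _ _ _ _ _ => erefl).

Definition tensoring_atom (X : C) : tensoring.
Proof.
by refine (@Tensoring X (tensl_functor X) (fun W => idm _) (fun W => idm _) _ _ _)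
  => *; rewrite ?comp1m ?compm1.
Defined.

Definition tensoring_unit : tensoring :=
  @Tensoring munit id_functor lunit luniti lunitK lunitiK lunit_nat.

(** The two bracketings of a triple product get functors with convertible values, so a component of
    an associator can be equated with an identity without any transport. *)
Definition tensoring_tens (a b : tensoring) : tensoring.
Proof.
refine (@Tensoring (a ⊗ b) (comp_functor (tens_fun a) (tens_fun b))
  (fun W => tens_iso a (tens_fun b W) ∘ (idm a ⊠ tens_iso b W) ∘ assoc a b W)
  (fun W => associ a b W ∘ (idm a ⊠ tens_inv b W) ∘ tens_inv a (tens_fun b W))
  _ _ _).
- move=> W; rewrite -!compA (compA (tens_inv a _)) tens_isoK comp1m.
  by rewrite (wl_cancel (tens_isoK b W)) assocK.
- move=> W; rewrite -!compA associKt (wl_cancel (tens_invK b W)).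
  exact: tens_invK.
- move=> W W' f; apply: homext => V x; rewrite -!compA assoc3 -wlM tens_iso_nat.
  by rewrite wlM compA tens_iso_nat -compA.
Defined.

End Tensoring.

(* These let [str] below find the tensor structure of the source and of the
   target of a morphism; an object of any other form is an atom. *)
Canonical tensoring_atom.
Canonical tensoring_unit.
Canonical tensoring_tens.

Local Notation "a · W" := (fob (tens_fun a) W) (at level 38, right associativity).

(** * Morphisms as natural transformations: a faithful strict calculus *)

Section Strictification.
Context (C : category) (M : monoidal C).
Implicit Types a b c : tensoring M.

(* [locked] (also in [str], [pairing] and [copairing]) keeps unification from
   unfolding these maps while rewriting. *)
Definition whisker a W W' (f : mor W W') : mor (a · W) (a · W') :=
  locked (fmap (tens_fun a) f).

Local Notation "a ▷ f" := (whisker a f) (at level 38, right associativity).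

Lemma whiskerE a W W' (f : mor W W') : a ▷ f = fmap (tens_fun a) f.
Proof. by rewrite /whisker -lock. Qed.

Lemma whisker1 a W : a ▷ idm W = idm _.
Proof. by rewrite whiskerE fmap1. Qed.

Lemma whiskerM a W W' W'' (g : mor W' W'') (f : mor W W') :
  a ▷ (g ∘ f) = (a ▷ g) ∘ (a ▷ f).
Proof. by rewrite !whiskerE fmapM. Qed.

Lemma whisker_tens a b W W' (f : mor W W') :
  tensoring_tens a b ▷ f = a ▷ b ▷ f.
Proof. by rewrite !whiskerE. Qed.

Lemma whisker_unit W W' (f : mor W W') : tensoring_unit M ▷ f = f.
Proof. by rewrite !whiskerE. Qed.

Definition str a b (f : mor (tens_ob a) (tens_ob b)) W : mor (a · W) (b · W) :=
  locked (tens_iso b W ∘ (f ⊠ idm W) ∘ tens_inv a W).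

Let strU a b (f : mor (tens_ob a) (tens_ob b)) W :
  str f W = tens_iso b W ∘ (f ⊠ idm W) ∘ tens_inv a W.
Proof. by rewrite /str -lock. Qed.

(** The component at the unit object is [f ⊠ idm munit] up to isomorphisms, and tensoring with the
    unit is faithful. *)
Lemma str_inj a b (f g : mor (tens_ob a) (tens_ob b)) :
  (forall W, str f W = str g W) -> f = g.
Proof.
move=> e; apply: wr1_inj; apply: homext => V x.
have := congr1 (fun y => tens_inv b _ ∘ y ∘ tens_iso a _ ∘ x) (e munit).
rewrite !strU -!compA !(compA (tens_inv _ _) (tens_iso _ _)) !tens_isoK.
by rewrite !comp1m.
Qed.

Lemma str_id a W : str (idm (tens_ob a)) W = idm _.
Proof. by rewrite !strU tensm1 comp1m tens_invK. Qed.

Lemma str_comp a b c (g : mor (tens_ob b) (tens_ob c))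
    (f : mor (tens_ob a) (tens_ob b)) W :
  str (g ∘ f) W = str g W ∘ str f W.
Proof.
rewrite !strU -!compA (compA (tens_inv b W)) tens_isoK comp1m.
by rewrite wrM.
Qed.

Lemma tens_inv_nat a W W' (f : mor W W') :
  tens_inv a W' ∘ (a ▷ f) = (idm (tens_ob a) ⊠ f) ∘ tens_inv a W.
Proof.
rewrite whiskerE -[RHS]comp1m -(tens_isoK a) -!compA (compA (tens_iso a W')).
by rewrite tens_iso_nat -!compA tens_invK compm1.
Qed.

Lemma str_nat a b (f : mor (tens_ob a) (tens_ob b)) W W' (h : mor W W') :
  str f W' ∘ (a ▷ h) = (b ▷ h) ∘ str f W.
Proof.
rewrite !strU -!compA tens_inv_nat -wswap whiskerE compA tens_iso_nat.
by rewrite -compA.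
Qed.

(** By [str_nat] the two factors may act in either order; always letting [g] act first gives a
    normal form. *)
Lemma str_tens a a' b b' (f : mor (tens_ob a) (tens_ob a'))
    (g : mor (tens_ob b) (tens_ob b')) W :
  str (f ⊠ g) W = str f (b' · W) ∘ (a ▷ str g W).
Proof.
rewrite !strU /= -!compA tens_inv_nat [f ⊠ g]tensm_split wrM assoc1 assoc2.
by rewrite associKt !wswap !wlM.
Qed.

(** By the pentagon, the associator is exactly the difference between the comparison isomorphisms of
    the two bracketings. *)
Lemma str_assoc a b c W : str (assoc (tens_ob a) (tens_ob b) (tens_ob c)) W = idm _.
Proof.
rewrite !strU /= -!compA !wlM -?compA -pentagont associKt -assoc3.
rewrite (wl_cancel (tens_invK c W)) associKt (wl_cancel (tens_invK b _)).
exact: tens_invK.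
Qed.

Lemma str_associ a b c W :
  str (associ (tens_ob a) (tens_ob b) (tens_ob c)) W = idm _.
Proof.
have := str_comp (assoc a b c) (associ a b c) W.
by rewrite associK str_id str_assoc comp1m.
Qed.

Lemma str_lunit a W : str (lunit (tens_ob a)) W = idm _.
Proof.
rewrite !strU /= lunit_tensi lunit_natt lunitiK compm1.
exact: tens_invK.
Qed.

Lemma str_luniti a W : str (luniti (tens_ob a)) W = idm _.
Proof.
have := str_comp (lunit a) (luniti a) W.
by rewrite lunitiK str_id str_lunit comp1m.
Qed.

(** The triangle axiom turns the right unitor into the left unitor of [W], which cancels the
    [luniti] contained in the inverse comparison map. *)
Lemma str_runit a W : str (runit (tens_ob a)) W = idm _.
Proof.
rewrite !strU /= trianglei (wl_cancel (lunitiK W)).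
exact: tens_invK.
Qed.

Lemma str_runiti a W : str (runiti (tens_ob a)) W = idm _.
Proof.
have := str_comp (runit a) (runiti a) W.
by rewrite runitiK str_id str_runit comp1m.
Qed.

End Strictification.

Local Notation "a ▷ f" := (whisker a f) (at level 38, right associativity).
Local Notation "⟨ X ⟩" := (tensoring_atom _ X) (format "⟨ X ⟩").

Definition strE := (str_comp, str_tens, str_id, str_assoc, str_associ,
  str_lunit, str_luniti, str_runit, str_runiti).
Definition whiskE := (whisker1, whisker_tens, whisker_unit, whiskerM).

(** * Frobenius algebra identities in the strict calculus *)

Section StrictFrobenius.
Context (C : category) (M : monoidal C) (A : frobenius_algebra M).
Implicit Types (a b : tensoring M) (X Y Z W : C).

Definition pairing : mor (A ⊗ A) munit := locked (counit A ∘ amul A).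
Definition copairing : mor munit (A ⊗ A) := locked (comul A ∘ aone A).

Lemma pairingE : pairing = counit A ∘ amul A.
Proof. by rewrite /pairing -lock. Qed.

Lemma copairingE : copairing = comul A ∘ aone A.
Proof. by rewrite /copairing -lock. Qed.

Local Notation µ := (str (amul A)).
Local Notation η := (str (aone A)).
Local Notation Δ := (str (comul A)).
Local Notation ε := (str (counit A)).
Local Notation β := (str pairing).
Local Notation κ := (str copairing).

Ltac strictify rules :=
  rewrite ?rules /= ?whiskE /= ?comp1m ?compm1 ?whisker1 ?comp1m ?compm1 -?compA.

Lemma str_amulA W : µ W ∘ µ (⟨A⟩ · W) = µ W ∘ (⟨A⟩ ▷ µ W).
Proof. by have := congr1 (fun f => str f W) (amulA A); strictify strE. Qed.

Lemma str_amul1l W : µ W ∘ η (⟨A⟩ · W) = idm _.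
Proof. by have := congr1 (fun f => str f W) (amul1l A); strictify strE. Qed.

Lemma str_amul1r W : µ W ∘ (⟨A⟩ ▷ η W) = idm _.
Proof. by have := congr1 (fun f => str f W) (amul1r A); strictify strE. Qed.

Lemma str_comul1l W : ε (⟨A⟩ · W) ∘ Δ W = idm _.
Proof. by have := congr1 (fun f => str f W) (comul1l A); strictify strE. Qed.

Lemma str_comul1r W : (⟨A⟩ ▷ ε W) ∘ Δ W = idm _.
Proof. by have := congr1 (fun f => str f W) (comul1r A); strictify strE. Qed.

Lemma str_frobl W : µ (⟨A⟩ · W) ∘ (⟨A⟩ ▷ Δ W) = Δ W ∘ µ W.
Proof. by have := congr1 (fun f => str f W) (frobl A); strictify strE. Qed.

Lemma str_frobr W : (⟨A⟩ ▷ µ W) ∘ Δ (⟨A⟩ · W) = Δ W ∘ µ W.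
Proof. by have := congr1 (fun f => str f W) (frobr A); strictify strE. Qed.

Lemma str_amul_nat W W' (h : mor W W') :
  (⟨A⟩ ▷ h) ∘ µ W = µ W' ∘ (⟨A⟩ ▷ ⟨A⟩ ▷ h).
Proof. by rewrite -str_nat whisker_tens. Qed.

Lemma pairing_nat W W' (h : mor W W') : h ∘ β W = β W' ∘ (⟨A⟩ ▷ ⟨A⟩ ▷ h).
Proof. by have := str_nat pairing h; rewrite whisker_unit whisker_tens. Qed.

Lemma copairing_nat W W' (h : mor W W') : (⟨A⟩ ▷ ⟨A⟩ ▷ h) ∘ κ W = κ W' ∘ h.
Proof. by have := str_nat copairing h; rewrite whisker_unit whisker_tens. Qed.

Lemma pairing_assoc W : β W ∘ µ (⟨A⟩ · W) = β W ∘ (⟨A⟩ ▷ µ W).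
Proof. by rewrite pairingE str_comp -!compA str_amulA. Qed.

(** The Frobenius relation moves the comultiplication after the product, where the counit cancels
    it. *)
Lemma pairing_comull W : (⟨A⟩ ▷ β W) ∘ Δ (⟨A⟩ · W) = µ W.
Proof.
by rewrite pairingE str_comp whiskerM -compA str_frobr compA str_comul1r comp1m.
Qed.

Lemma pairing_comulr W : β (⟨A⟩ · W) ∘ (⟨A⟩ ▷ Δ W) = µ W.
Proof. by rewrite pairingE str_comp -compA str_frobl compA str_comul1l comp1m. Qed.

(** Dually, the Frobenius relation moves the product before the comultiplication, where it absorbs
    the unit. *)
Lemma amul_copairingl W : µ (⟨A⟩ · W) ∘ (⟨A⟩ ▷ κ W) = Δ W.
Proof.
by rewrite copairingE str_comp whiskerM compA str_frobl -compA str_amul1r compm1.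
Qed.

Lemma amul_copairingr W : (⟨A⟩ ▷ µ W) ∘ κ (⟨A⟩ · W) = Δ W.
Proof. by rewrite copairingE str_comp compA str_frobr -compA str_amul1l compm1. Qed.

Lemma str_mult a b W : str (Phi_mult A a b) W = ⟨A⟩ ▷ a ▷ β (b · ⟨A⟩ · W).
Proof. by rewrite /Phi_mult /Phi_assoc -pairingE; strictify strE. Qed.

Lemma str_comult a b W : str (Phi_comult A a b) W = ⟨A⟩ ▷ a ▷ κ (b · ⟨A⟩ · W).
Proof. by rewrite /Phi_comult /Phi_associ -copairingE; strictify strE. Qed.

Lemma str_lact a W : str (free_lact A a) W = µ (a · ⟨A⟩ · W).
Proof. by rewrite /free_lact; strictify strE. Qed.

Lemma str_ract a W : str (free_ract A a) W = ⟨A⟩ ▷ a ▷ µ W.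
Proof. by rewrite /free_ract; strictify strE. Qed.

Lemma str_unit W : str (Phi_unit A) W = Δ W.
Proof. by rewrite /Phi_unit; strictify strE. Qed.

Lemma str_counit W : str (Phi_counit A) W = µ W.
Proof. by rewrite /Phi_counit; strictify strE. Qed.

Definition str_PhiE := (str_mult, str_comult, str_lact, str_ract, str_unit,
  str_counit, strE).

Ltac strict W := apply: str_inj => W; strictify str_PhiE.

(* The tensorings are explicit because [strictify] has simplified the objects
   [a · W] from which unification would have to recover [a]. *)
Ltac gather X := rewrite -!(whiskerM ⟨A⟩) -!(whiskerM ⟨X⟩).

(** * Relations for the structure maps before passing to the quotient *)

Local Notation m := (Phi_mult A).
Local Notation d := (Phi_comult A).
Local Notation l := (free_lact A).
Local Notation r := (free_ract A).
Local Notation u := (Phi_unit A).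
Local Notation v := (Phi_counit A).
Local Notation F X := ((A ⊗ X) ⊗ A).
Local Notation Fm f := ((idm A ⊠ f) ⊠ idm A).

Lemma Phi_mult_bal X Y :
  m X Y ∘ (r X ⊠ idm (F Y)) = m X Y ∘ (idm (F X) ⊠ l Y) ∘ assoc (F X) A (F Y).
Proof. by strict W; gather X; rewrite pairing_assoc. Qed.

(** The left action only touches the leftmost factor [A] and the pairing lies to its right, so the
    two commute. *)
Lemma Phi_mult_lact X Y :
  m X Y ∘ (l X ⊠ idm (F Y)) ∘ associ A (F X) (F Y)
  = l (X ⊗ Y) ∘ (idm A ⊠ m X Y).
Proof. by strict W; rewrite str_amul_nat. Qed.

Lemma Phi_mult_ract X Y :
  m X Y ∘ (idm (F X) ⊠ r Y) ∘ assoc (F X) (F Y) A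
  = r (X ⊗ Y) ∘ (m X Y ⊠ idm A).
Proof. by strict W; gather X; rewrite pairing_nat. Qed.

Lemma Phi_mult_nat X Y X' Y' (f : mor X X') (g : mor Y Y') :
  m X' Y' ∘ (Fm f ⊠ Fm g) = Fm (f ⊠ g) ∘ m X Y.
Proof.
strict W; gather X.
(* Moving [f] past the pairing changes the whiskering of the pairing from [X'] to [X], so that it
   can be merged with the action of [g]. *)
rewrite [_ ∘ str f _ ∘ _]compA -(str_nat f) -compA.
by rewrite -!(whiskerM ⟨X⟩) pairing_nat.
Qed.

Lemma Phi_mult_assoc X Y Z :
  Fm (assoc X Y Z) ∘ m (X ⊗ Y) Z ∘ (m X Y ⊠ idm (F Z))
  = m X (Y ⊗ Z) ∘ (idm (F X) ⊠ m Y Z) ∘ assoc (F X) (F Y) (F Z).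
Proof. by strict W; gather X; rewrite pairing_nat. Qed.

Lemma Phi_mult_unitl X : Fm (lunit X) ∘ m munit X ∘ (u ⊠ idm (F X)) = l X.
Proof. by strict W; rewrite pairing_comull. Qed.

Lemma Phi_mult_unitr X : Fm (runit X) ∘ m X munit ∘ (idm (F X) ⊠ u) = r X.
Proof. by strict W; gather X; rewrite pairing_comulr. Qed.

Lemma Phi_unit_lact : u ∘ amul A = l munit ∘ (idm A ⊠ u).
Proof. by strict W; rewrite str_frobl. Qed.

Lemma Phi_unit_ract : u ∘ amul A = r munit ∘ (u ⊠ idm A).
Proof. by strict W; rewrite str_frobr. Qed.

Lemma Phi_comult_lact X Y :
  (l X ⊠ idm (F Y)) ∘ associ A (F X) (F Y) ∘ (idm A ⊠ d X Y)
  = d X Y ∘ l (X ⊗ Y).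
Proof. by strict W; rewrite str_amul_nat. Qed.

Lemma Phi_comult_ract X Y :
  (idm (F X) ⊠ r Y) ∘ assoc (F X) (F Y) A ∘ (d X Y ⊠ idm A)
  = d X Y ∘ r (X ⊗ Y).
Proof. by strict W; gather X; rewrite copairing_nat. Qed.

Lemma Phi_comult_nat X Y X' Y' (f : mor X X') (g : mor Y Y') :
  (Fm f ⊠ Fm g) ∘ d X Y = d X' Y' ∘ Fm (f ⊠ g).
Proof.
strict W; gather X.
by rewrite copairing_nat (whiskerM ⟨X⟩) compA -(str_nat f) -compA.
Qed.

Lemma Phi_comult_assoc X Y Z :
  assoc (F X) (F Y) (F Z) ∘ (d X Y ⊠ idm (F Z)) ∘ d (X ⊗ Y) Z
  = (idm (F X) ⊠ d Y Z) ∘ d X (Y ⊗ Z) ∘ Fm (assoc X Y Z).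
Proof. by strict W; gather X; rewrite copairing_nat. Qed.

(** The pairing acts between [X] and [Y], the copairing between [Y] and [Z]; having disjoint
    supports, they commute. *)
Lemma Phi_mult_comult_l X Y Z :
  (m X Y ⊠ idm (F Z)) ∘ associ (F X) (F Y) (F Z) ∘ (idm (F X) ⊠ d Y Z)
  = d (X ⊗ Y) Z ∘ Fm (associ X Y Z) ∘ m X (Y ⊗ Z).
Proof. by strict W; gather X; rewrite pairing_nat. Qed.

Lemma Phi_mult_comult_r X Y Z :
  (idm (F X) ⊠ m Y Z) ∘ assoc (F X) (F Y) (F Z) ∘ (d X Y ⊠ idm (F Z))
  = d X (Y ⊗ Z) ∘ Fm (assoc X Y Z) ∘ m (X ⊗ Y) Z.
Proof. by strict W; gather X; rewrite copairing_nat. Qed.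

Lemma Phi_counit_lact : v ∘ l munit = amul A ∘ (idm A ⊠ v).
Proof. by strict W; rewrite str_amulA. Qed.

Lemma Phi_counit_ract : v ∘ r munit = amul A ∘ (v ⊠ idm A).
Proof. by strict W; rewrite str_amulA. Qed.

Hypothesis amul_comul : amul A ∘ comul A = idm (A : C).

Lemma str_amul_comul W : µ W ∘ Δ W = idm _.
Proof. by rewrite -str_comp amul_comul str_id. Qed.

(** Multiplying the first leg of the copairing by [v] creates a comultiplication, which the left
    action then multiplies back. *)
Lemma Phi_comult_counitl X :
  l X ∘ (v ⊠ idm (F X)) ∘ d munit X = Fm (lunit X).
Proof. by strict W; rewrite amul_copairingl str_amul_comul. Qed.

Lemma Phi_comult_counitr X :
  r X ∘ (idm (F X) ⊠ v) ∘ d X munit = Fm (runit X).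
Proof.
by strict W; gather X; rewrite amul_copairingr str_amul_comul !whisker1.
Qed.

End StrictFrobenius.

(** * Descent to the tensor product over the algebra *)

Section PhiFrobenius.
Context (k : fieldType) (C : fusion_category k).
Context (A : frobenius_algebra (fus_mon C)).
Implicit Types X Y Z : C.

Local Notation ΦA := (free_bimodule A).
Local Notation m := (Phi_mult A).
Local Notation d := (Phi_comult A).
Local Notation ϖ X Y := (projA (ΦA X) (ΦA Y)).

Lemma Phi2_ex X Y :
  {h : mor (tensA (ΦA X) (ΦA Y) : C) (ΦA (X ⊗ Y)) | h ∘ ϖ X Y = m X Y}.
Proof.
apply: projA_desc => V x.
by have := tail (Phi_mult_bal A X Y) x; rewrite -!compA.
Qed.

Definition Phi2_hom X Y := projT1 (Phi2_ex X Y).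

Lemma Phi2_hom0E X Y : Phi2_hom X Y ∘ ϖ X Y = m X Y.
Proof. exact: projT2 (Phi2_ex X Y). Qed.

Lemma Phi2_homE X Y V (x : mor V _) : Phi2_hom X Y ∘ ϖ X Y ∘ x = m X Y ∘ x.
Proof. by rewrite compA Phi2_hom0E. Qed.

(** Both sides are compared after composing with [A] tensored with the projection, which remains an
    epimorphism by rigidity. *)
Lemma Phi2_l X Y :
  Phi2_hom X Y ∘ lact (tensA (ΦA X) (ΦA Y))
  = lact (ΦA (X ⊗ Y)) ∘ (idm (A : C) ⊠ Phi2_hom X Y).
Proof.
apply: (wl_epi (@projA_epi _ _ _ (ΦA X) (ΦA Y))); apply: homext => V x.
rewrite -!compA projA_lact Phi2_homE -wlM Phi2_hom0E.
by have := tail (Phi_mult_lact A X Y) x; rewrite -!compA.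
Qed.

Lemma Phi2_r X Y :
  Phi2_hom X Y ∘ ract (tensA (ΦA X) (ΦA Y))
  = ract (ΦA (X ⊗ Y)) ∘ (Phi2_hom X Y ⊠ idm (A : C)).
Proof.
apply: (wr_epi (@projA_epi _ _ _ (ΦA X) (ΦA Y))); apply: homext => V x.
rewrite -!compA projA_ract Phi2_homE -[in RHS]wrM Phi2_hom0E.
by have := tail (Phi_mult_ract A X Y) x; rewrite -!compA.
Qed.

Definition Phi2 X Y : bimodule_hom (tensA (ΦA X) (ΦA Y)) (ΦA (X ⊗ Y)) :=
  BimoduleHom (Phi2_l X Y) (Phi2_r X Y).

Definition Phi0 : bimodule_hom (regular A) (ΦA munit) :=
  @BimoduleHom _ _ A (regular A) (ΦA munit) (Phi_unit A)
    (Phi_unit_lact A) (Phi_unit_ract A).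

(** The compatibility holds for [d] before projecting, and the induced action is defined so that the
    projection preserves it. *)
Lemma coPhi2_l X Y :
  (ϖ X Y ∘ d X Y) ∘ lact (ΦA (X ⊗ Y))
  = lact (tensA (ΦA X) (ΦA Y)) ∘ (idm (A : C) ⊠ (ϖ X Y ∘ d X Y)).
Proof.
apply: homext => V x; rewrite wlM0 -!compA projA_lact; congr (_ ∘ _).
by have := tail (Phi_comult_lact A X Y) x; rewrite -!compA.
Qed.

Lemma coPhi2_r X Y :
  (ϖ X Y ∘ d X Y) ∘ ract (ΦA (X ⊗ Y))
  = ract (tensA (ΦA X) (ΦA Y)) ∘ ((ϖ X Y ∘ d X Y) ⊠ idm (A : C)).
Proof.
apply: homext => V x; rewrite wrM0 -!compA projA_ract; congr (_ ∘ _).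
by have := tail (Phi_comult_ract A X Y) x; rewrite -!compA.
Qed.

Definition coPhi2 X Y : bimodule_hom (ΦA (X ⊗ Y)) (tensA (ΦA X) (ΦA Y)) :=
  BimoduleHom (coPhi2_l X Y) (coPhi2_r X Y).

Definition coPhi0 : bimodule_hom (ΦA munit) (regular A) :=
  @BimoduleHom _ _ A (ΦA munit) (regular A) (Phi_counit A)
    (Phi_counit_lact A) (Phi_counit_ract A).

Lemma Phi_monoidal : @is_monoidal_functor _ _ _ _ (Phi A) Phi2 Phi0.
Proof.
split.
- move=> X Y X' Y' f f'; apply: bhom_inj => /=.
  apply: (@projA_epi _ _ _ (ΦA X) (ΦA X')); apply: homext => V x.
  rewrite -!compA projA_mor !Phi2_homE.
  by have := tail (Phi_mult_nat A f f') x; rewrite -!compA.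
- move=> X Y Z; apply: bhom_inj => /=.
  (* The source is an iterated quotient, so the two projections are cancelled in turn. *)
  apply: (@projA_epi _ _ _ (tensA (ΦA X) (ΦA Y)) (ΦA Z)).
  apply: (wr_epi (@projA_epi _ _ _ (ΦA X) (ΦA Y))); apply: homext => V x.
  rewrite -!compA projA_mor Phi2_homE -[in LHS]wrM Phi2_hom0E.
  rewrite assocA_homE projA_mor Phi2_homE -[in RHS]wlM Phi2_hom0E.
  by have := tail (Phi_mult_assoc A X Y Z) x; rewrite -!compA.
- move=> X; apply: bhom_inj => /=.
  apply: (@projA_epi _ _ _ (regular A) (ΦA X)); apply: homext => V x.
  rewrite -!compA projA_mor Phi2_homE lunitA_homE.
  by have := tail (Phi_mult_unitl A X) x; rewrite -!compA.
- move=> X; apply: bhom_inj => /=.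
  apply: (@projA_epi _ _ _ (ΦA X) (regular A)); apply: homext => V x.
  rewrite -!compA projA_mor Phi2_homE runitA_homE.
  by have := tail (Phi_mult_unitr A X) x; rewrite -!compA.
Qed.

Lemma Phi_comonoidal :
  amul A ∘ comul A = idm (A : C) ->
  @is_comonoidal_functor _ _ _ _ (Phi A) coPhi2 coPhi0.
Proof.
move=> amul_comul; split.
- move=> X Y X' Y' f f'; apply: bhom_inj => /=; apply: homext => V x.
  rewrite -!compA projA_mor; congr (_ ∘ _).
  by have := tail (Phi_comult_nat A f f') x; rewrite -!compA.
- move=> X Y Z; apply: bhom_inj => /=; apply: homext => V x.
  (* Both sides now end in the same two projections, leaving coassociativity of [d]. *)
  rewrite -!compA !projA_mor /= wrM wlM assocA_homE; congr (_ ∘ _ ∘ _).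
  by have := tail (Phi_comult_assoc A X Y Z) x; rewrite -!compA.
- move=> X; apply: bhom_inj => /=; apply: homext => V x.
  rewrite -!compA projA_mor lunitA_homE.
  by have := tail (Phi_comult_counitl amul_comul X) x; rewrite -!compA.
- move=> X; apply: bhom_inj => /=; apply: homext => V x.
  rewrite -!compA projA_mor runitA_homE.
  by have := tail (Phi_comult_counitr amul_comul X) x; rewrite -!compA.
Qed.

(** Precomposing with the projection of the source replaces each constraint and structure map by its
    lift; a projection common to both sides then drops out. *)
Lemma Phi_frobl X Y Z :
  bimodule_comp (tensAm (Phi2 X Y) (bimodule_id (ΦA Z)))
    (bimodule_comp (associA (ΦA X) (ΦA Y) (ΦA Z))
      (tensAm (bimodule_id (ΦA X)) (coPhi2 Y Z)))
  = bimodule_comp (coPhi2 (X ⊗ Y) Z)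
      (bimodule_comp (free_hom A (associ X Y Z)) (Phi2 X (Y ⊗ Z))).
Proof.
apply: bhom_inj; apply: (@projA_epi _ _ _ (ΦA X) (ΦA (Y ⊗ Z))).
apply: homext => V x; rewrite /= -!compA projA_mor /= wlM associA_homE projA_mor.
rewrite /= -wrM Phi2_hom0E Phi2_homE; congr (_ ∘ _).
by have := tail (Phi_mult_comult_l A X Y Z) x; rewrite -!compA.
Qed.

Lemma Phi_frobr X Y Z :
  bimodule_comp (tensAm (bimodule_id (ΦA X)) (Phi2 Y Z))
    (bimodule_comp (assocA (ΦA X) (ΦA Y) (ΦA Z))
      (tensAm (coPhi2 X Y) (bimodule_id (ΦA Z))))
  = bimodule_comp (coPhi2 X (Y ⊗ Z))
      (bimodule_comp (free_hom A (assoc X Y Z)) (Phi2 (X ⊗ Y) Z)).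
Proof.
apply: bhom_inj; apply: (@projA_epi _ _ _ (ΦA (X ⊗ Y)) (ΦA Z)).
apply: homext => V x; rewrite /= -!compA projA_mor /= wrM assocA_homE projA_mor.
rewrite /= -wlM Phi2_hom0E Phi2_homE; congr (_ ∘ _).
by have := tail (Phi_mult_comult_r A X Y Z) x; rewrite -!compA.
Qed.

End PhiFrobenius.

Theorem theorem3p2 (k : closedFieldType) (k_char0 : [pchar k] =i pred0)
    (C : fusion_category k) (A : frobenius_algebra (fus_mon C))
    (A_special : special A) :
  exists (F2 : forall X X' : C,
            mor (Phi A X ⊗ Phi A X') (Phi A (X ⊗ X')))
         (F0 : mor (munit : bimodule_category A) (Phi A munit))
         (G2 : forall X X' : C,
            mor (Phi A (X ⊗ X')) (Phi A X ⊗ Phi A X'))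
         (G0 : mor (Phi A munit) (munit : bimodule_category A)),
    [/\ forall X X' : C,
          unique (fun f : mor (Phi A X ⊗ Phi A X') (Phi A (X ⊗ X')) =>
                    bhom f ∘ projA (Phi A X) (Phi A X') = Phi_mult A X X')
                 (F2 X X'),
        bhom F0 = Phi_unit A,
        forall X X' : C,
          bhom (G2 X X') = projA (Phi A X) (Phi A X') ∘ Phi_comult A X X',
        bhom G0 = Phi_counit A
      & is_frobenius_monoidal_functor F2 F0 G2 G0].
Proof.
have [amul_comul _] := A_special.
exists (Phi2 A), (Phi0 A), (coPhi2 A), (coPhi0 A); split=> //.
- move=> X X'; split=> [|f ef]; first exact: Phi2_hom0E.
  (* Uniqueness: a bimodule map is determined by its underlying morphism, and that one by its
     composite with the epimorphic projection. *)
  apply: bhom_inj.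
  apply: (@projA_epi _ _ _ (free_bimodule A X) (free_bimodule A X')).
  by rewrite ef; apply: Phi2_hom0E.
- split; first exact: Phi_monoidal.
  + exact: Phi_comonoidal.
  + exact: Phi_frobl.
  + exact: Phi_frobr.
Qed.
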